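(* Let $\xi$ be a non-negative integer-valued random variable with $\mathbb{E}\xi=1$ and $0<\mathrm{Var}(\xi)<\infty$, and let $\mathcal{T}_n$ be the Galton-Watson tree with offspring distribution $\xi$ conditioned to have $n$ nodes. Assume that $p_1:=\mathbb{P}(\xi=1)>0$. Let $\overline{H}_{n,1}$ be the height of the maximal chain (complete $1$-ary) non-fringe subtree in $\mathcal{T}_n$. Then, as $n\to\infty$, $$\frac{\overline{H}_{n,1}}{\log_{1/p_1}n}\to1\quad\text{in probability.}$$
   Context: A plane tree is a finite rooted, ordered, unlabeled tree. For a node $v$ of $T$, the fringe subtree $T_v$ consists of $v$ and all its descendants. A plane tree $T$ contains $T'$ as a non-fringe subtree if for some node $v$ of $T$ the tree $T_v$ can be made isomorphic (as a plane tree) to $T'$ by replacing some or none of its own fringe subtrees with leaves. The chain of height $h$ is the tree with $h+1$ nodes in which every node except the single leaf has exactly one child; so $\overline{H}_{n,1}$ is the largest $h$ such that $\mathcal{T}_n$ contains the chain of height $h$ as a non-fringe subtree. The Galton-Watson tree is generated from the root by giving each node independently a number of children distributed as $\xi$. Since $p_1>0$, the conditioning on size $n$ is well defined for all large $n$. *)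

(* Defs.v *)
From mathcomp Require Import all_boot all_order all_algebra.
From mathcomp Require Import finmap.
From mathcomp Require Import all_classical all_reals all_analysis.
Set Implicit Arguments.
Unset Strict Implicit.
Unset Printing Implicit Defensive.
Import Order.TTheory GRing.Theory Num.Theory.
Import numFieldNormedType.Exports.
Local Open Scope classical_set_scope.
Local Open Scope ring_scope.

Inductive tree := Node of seq tree.

Definition children (t : tree) : seq tree := let: Node s := t in s.

Definition leaf : tree := Node [::].

Fixpoint tree_size (t : tree) : nat :=
  let: Node s := t in (sumn (map tree_size s)).+1.

(* Nodes are addressed by Ulam-Harris words, children being numbered from 0:  *)
(* [:: i; j] is child j of child i of the root. The value is None when the    *)
(* word u is not the address of a node of t.                                  *)
Fixpoint fringe_subtree (t : tree) (u : seq nat) : option tree :=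
  if u is i :: v then
    if onth (children t) i is Some c then fringe_subtree c v else None
  else Some t.

(* pruned t t' : t' arises from t by replacing some or none of the fringe     *)
(* subtrees of t with leaves.                                                 *)
Inductive pruned : tree -> tree -> Prop :=
| pruned_cut (t : tree) : pruned t leaf
| pruned_keep (s s' : seq tree) :
    size s = size s' ->
    (forall i, (i < size s)%N -> pruned (nth leaf s i) (nth leaf s' i)) ->
    pruned (Node s) (Node s').

Definition contains_nonfringe (t t' : tree) : Prop :=
  exists (u : seq nat) (s : tree), fringe_subtree t u = Some s /\ pruned s t'.

Definition chain (h : nat) : tree := iter h (fun t => Node [:: t]) leaf.

(* Bounding h by the size of t loses nothing, as a contained chain of height  *)
(* h needs h.+1 nodes; see Hbar1_max.                                         *)
Definition Hbar1 (t : tree) : nat :=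
  \max_(h < tree_size t | `[< contains_nonfringe t (chain h) >]) h.

Lemma fringe_subtree_size t u s :
  fringe_subtree t u = Some s -> (tree_size s <= tree_size t)%N.
Proof.
elim: u t => [t [->] //|i v IH [l]] /=.
case E : (onth l i) => [c|] // /IH sc; apply: (leq_trans sc).
apply: leq_trans (leqnSn _).
elim: l i E {IH sc} => [|a l IHl] [|i] //=; first by move=> [->]; exact: leq_addr.
by move/IHl => h; apply: (leq_trans h); exact: leq_addl.
Qed.

Lemma pruned_chain_size h t : pruned t (chain h) -> (h < tree_size t)%N.
Proof.
elim: h t => [[l] //|h IH t] /= H; inversion H as [|s s' ss Hs]; subst.
case: s ss Hs {H} => [|a [|b s]] //= _ /(_ 0 isT) /= /IH.
by rewrite addn0.
Qed.

Lemma contains_chain_size t h :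
  contains_nonfringe t (chain h) -> (h < tree_size t)%N.
Proof.
move=> [u [s [/fringe_subtree_size us /pruned_chain_size hs]]].
exact: leq_trans us.
Qed.

Lemma Hbar1_max t h : contains_nonfringe t (chain h) -> (h <= Hbar1 t)%N.
Proof.
move=> H; have ht := contains_chain_size H.
by apply: (@leq_bigmax_cond _ _ (fun i : 'I__ => val i) (Ordinal ht)); apply/asboolP.
Qed.

Lemma Hbar1_contains t : contains_nonfringe t (chain (Hbar1 t)).
Proof.
rewrite /Hbar1.
apply: (big_ind (fun m => contains_nonfringe t (chain m))).
- by exists [::], t; split => //; exact: pruned_cut.
- by move=> x y Hx Hy; case: (leqP x y) => _.
- by move=> i /asboolP.
Qed.

Section probability.
Context {R : realType} {d : measure_display} {Omega : measurableType d}
  (P : probability Omega R).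

Definition mutually_independent {I : choiceType} {d' : measure_display}
    {E : measurableType d'} (X : I -> {RV P >-> E}) : Prop :=
  forall (J : {fset I}) (B : I -> set E),
    (forall i, measurable (B i)) ->
    P (\bigcap_(i in [set` J]) (X i @^-1` B i)) =
      (\prod_(i <- J) P (X i @^-1` B i))%E.

(* The Galton-Watson tree generated by the offspring numbers X: a potential   *)
(* node u has X u children. It is a finite plane tree, namely t, exactly      *)
(* when every node of t has in t the number of children prescribed by X.      *)
Definition GW_eq (X : seq nat -> {RV P >-> nat}) (t : tree) : set Omega :=
  [set w | forall u s, fringe_subtree t u = Some s -> X u w = size (children s)].

Definition GW_size_in (X : seq nat -> {RV P >-> nat}) (n : nat)
    (A : set tree) : set Omega :=
  [set w | exists t, [/\ GW_eq X t w, tree_size t = n & A t]].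

(* P(T_n \in A), where T_n is the Galton-Watson tree conditioned to have n    *)
(* nodes.                                                                     *)
Definition cond_GW (X : seq nat -> {RV P >-> nat}) (n : nat)
    (A : set tree) : R :=
  fine (P (GW_size_in X n A)) / fine (P (GW_size_in X n setT)).

End probability.

Definition logb {R : realType} (b x : R) : R := ln x / ln b.

(* Main.v *)
Require Import Defs.
From HB Require Import structures.
From mathcomp Require Import all_boot all_order all_algebra.
From mathcomp Require Import finmap.
From mathcomp Require Import all_classical all_reals all_analysis.
From mathcomp Require Import measurable_realfun.
From mathcomp Require Import zify ring lra.
Import Order.TTheory GRing.Theory Num.Theory.
Import numFieldNormedType.Exports.

(** The weight of a tree under the Galton-Watson law is the product of the
    offspring probabilities along its preorder word of outdegrees.  A node with
    one child is followed in preorder by that child, so a chain of height h is a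
    run of h letters 1 in the word ([contains_chainP]).  Inserting or erasing
    letters 1 inside a word keeps it the word of a tree, as long as the word
    still ends with the leaf that comes last.  Hence, given the number k of
    unary nodes of a tree with N+1 nodes, the positions of the letters 1 form a
    uniformly random k-subset of the first N positions
    ([pattern_mass_erase], [tree_mass_positions]), and the theorem becomes a
    statement on the longest run in such a subset, provided that k is close to
    p1 * N.

    For a uniform k-subset with k/N close to p1 a given block of h positions is
    full with probability about p1^h.  A union bound over the N+1 starting
    points excludes runs longer than (1 + eps) log_{1/p1} n ([card_run_le]); a
    second moment bound over N/h disjoint blocks produces a run of length
    (1 - eps) log_{1/p1} n ([card_norun_le]).

    It remains to see that k/N is close to p1.  In the unconditioned word the
    number of letters 1 is binomial, and the weights of the reduced words add up
    to at most a power of 1 - p1, so the trees with an atypical k have a mass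
    that is exponentially small in N ([mass_le_positions], [binomial_tail]).
    This is negligible because the mass Z_n of all trees of size n decays slower
    than any exponential ([forest_mass_subexp]).  The reason for this slow decay
    is that, if Z_n were at most C y^-n with y > 1, the generating function Y of
    the Z_n would be finite at some x > 1 and would satisfy
    Y >= x * sum_k p_k Y^k >= x * sum_k p_k (1 + k (Y - 1)) = x Y, because the
    offspring law is critical; this is absurd as Y > 0 ([genfun_unbounded]).
    Supermultiplicativity of Z_n, obtained by hanging two trees below a common
    root, extends the lower bound to all n. *)

Set Implicit Arguments.
Unset Strict Implicit.
Unset Printing Implicit Defensive.
Local Open Scope ring_scope.

(** * Preorder words of plane trees, and chains as runs of ones *)

HB.instance Definition _ := gen_eqMixin tree.
HB.instance Definition _ := gen_choiceMixin tree.

Fixpoint word (t : tree) : seq nat :=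
  let: Node s := t in size s :: flatten (map word s).

Definition forest_word (s : seq tree) : seq nat := flatten (map word s).

Lemma forest_word_cat s s' : forest_word (s ++ s') = forest_word s ++
  forest_word s'.
Proof. by rewrite /forest_word map_cat flatten_cat. Qed.

Lemma forest_word1 t : forest_word [:: t] = word t.
Proof. by rewrite /forest_word /= cats0. Qed.

Lemma forest_word_Node c r :
  forest_word (Node c :: r) = size c :: forest_word (c ++ r).
Proof. by rewrite forest_word_cat. Qed.

(** Exposing the children of the first root removes one node and deletes the
    first letter of the word, so forests can be treated by induction on words
    rather than by nested induction on trees. *)
Lemma forest_ind (Q : seq tree -> Prop) :
  Q [::] -> (forall c r, Q (c ++ r) -> Q (Node c :: r)) -> forall s, Q s.
Proof.
move=> Q0 QN s; have [n] := ubnP (size (forest_word s)).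
elim: n s => // n IHn [//|[c] r]; rewrite forest_word_Node /= ltnS => le_n.
exact/QN/IHn.
Qed.

Lemma size_forest_word s : size (forest_word s) = sumn (map tree_size s).
Proof.
elim/forest_ind: s => // c r; rewrite forest_word_Node /= => ->.
by rewrite map_cat sumn_cat.
Qed.

(** All forests of [j] trees with [n] nodes in total, built along the same
    decomposition as [forest_ind]: a forest is given by the degree [d] of its
    first root and the forest obtained by deleting this root. *)
Fixpoint forests (n j : nat) : seq (seq tree) :=
  match n, j with
  | 0, 0 => [:: [::]]
  | n'.+1, j'.+1 => [seq Node (take d s) :: drop d s |
                      d <- iota 0 n, s <- forests n' (d + j')]
  | _, _ => [::]
  end.

Lemma forestsS n j :
  forests n.+1 j.+1 = [seq Node (take d s) :: drop d s |
                        d <- iota 0 n.+1, s <- forests n (d + j)].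
Proof. by []. Qed.

Lemma mem_forestsS n j s :
  reflect (exists d u, [/\ d \in iota 0 n.+1, u \in forests n (d + j) &
                          s = Node (take d u) :: drop d u])
          (s \in forests n.+1 j.+1).
Proof.
rewrite forestsS.
exact: (@allpairsPdep nat (fun=> seq tree) (seq tree)
  (fun d u => Node (take d u) :: drop d u) _ (fun d => forests n (d + j))).
Qed.

(** Every tree of a forest contributes at least its root. *)
Lemma size_forest_le s : (size s <= size (forest_word s))%N.
Proof.
by elim/forest_ind: s => // c r; rewrite forest_word_Node /= size_cat; lia.
Qed.

Lemma mem_forests n j s :
  (s \in forests n j) = (size s == j) && (size (forest_word s) == n).
Proof.
elim: n j s => [|n IHn] [|j] s.
- by rewrite inE; case: s => [|t s].
- apply/esym/negbTE/negP => /andP[/eqP sz /eqP wd].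
  by have := size_forest_le s; rewrite sz wd.
- by rewrite in_nil; case: s => //.
apply/idP/idP.
  move=> /mem_forestsS [d [s' [_ s'F ->]]].
  move: s'F; rewrite IHn => /andP[/eqP sz /eqP wd].
  by rewrite forest_word_Node /= cat_take_drop wd size_drop sz addKn !eqxx.
case: s => // -[c] r; rewrite forest_word_Node /= !eqSS =>
  /andP[/eqP sz /eqP wd].
apply/mem_forestsS; exists (size c), (c ++ r); split.
- rewrite mem_iota /= add0n ltnS -wd; apply: leq_trans (size_forest_le _).
  by rewrite size_cat leq_addr.
- by rewrite IHn size_cat sz wd !eqxx.
- by rewrite take_size_cat // drop_size_cat.
Qed.

Lemma uniq_forests n j : uniq (forests n j).
Proof.
elim: n j => [|n IHn] [|j] //; rewrite forestsS.
apply: (@allpairs_uniq_dep nat (fun=> seq tree) (seq tree)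
  (fun d u => Node (take d u) :: drop d u) _ (fun d => forests n (d + j)))
  => [||[d s] [d' s']].
- exact: iota_uniq.
- by move=> d _; exact: IHn.
have inP := @allpairsPdep nat (fun=> seq tree) _ _ _ (fun d =>
  forests n (d + j)).
move=> /inP [e [u [_ uF ->]]] /inP [e' [u' [_ uF' ->]]].
move: uF uF'; rewrite !mem_forests =>
  /andP[/eqP su _] /andP[/eqP su' _] /= [etk edr].
have edd : e = e'.
  by move: (congr1 size etk); rewrite !size_takel ?su ?su' ?leq_addr.
rewrite -edd in etk edr *.
by rewrite -(cat_take_drop e u) -(cat_take_drop e u') etk edr.
Qed.

Lemma big_forests (V : nmodType) n j (A : pred (seq tree)) (F : seq tree -> V) :
  \sum_(s <- forests n.+1 j.+1 | A s) F s =
  \sum_(d < n.+1) \sum_(s <- forests n (d + j) | A (Node (take d s) :: drop d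
    s))
     F (Node (take d s) :: drop d s).
Proof.
rewrite forestsS big_mkcond big_allpairs_dep.
rewrite -[iota 0 n.+1]/(index_iota 0 n.+1) big_mkord.
by apply: eq_bigr => d _; rewrite -big_mkcond.
Qed.

Lemma fringe_subtree_infix t u s :
  fringe_subtree t u = Some s -> infix (word s) (word t).
Proof.
elim: u t => [t [->]|i u IHu [l]]; first exact: infix_refl.
rewrite [fringe_subtree _ _]/=; case E: (onth l i) => [c|] // /IHu cs;
  apply: (infix_trans cs).
have [ltil|leli] := ltnP i (size l); last by move: E; rewrite onth_default.
apply/infixP.
exists (size l :: forest_word (take i l)), (forest_word (drop i.+1 l)).
rewrite /=; congr (_ :: _).
have -> : word c ++ forest_word (drop i.+1 l) = forest_word (c :: drop i.+1 l)
  by [].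
rewrite -forest_word_cat.
have -> : c = nth leaf l i by rewrite -odflt_onth E.
by rewrite -drop_nth // cat_take_drop.
Qed.

(** Cutting a tree down to a chain keeps the nodes on the path that starts
    at the root; these have one child each and come first in preorder. *)
Lemma pruned_chainE h s :
  pruned s (chain h) <-> prefix (nseq h 1) (word s).
Proof.
elim: h s => [|h IH] [l]; first by split => // _; exact: pruned_cut.
split.
  move=> /= H; inversion H as [|s s' ss Hs]; subst.
  case: l ss Hs {H} => [|a [|b s]] //= _ /(_ 0%N isT) /= /IH.
  by rewrite cats0.
case: l => [|a [|b l]] //=; rewrite cats0 => /IH ca.
by apply: pruned_keep => // -[|//] _.
Qed.

(** The last node in preorder is a leaf.  This is what confines a run of
    letters 1 to the word of a single tree of a forest. *)
Lemma last_word t x : last x (word t) = 0%N.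
Proof.
suff H s : last 0%N (forest_word s) = 0%N.
  by case: t => c /=; have := H [:: Node c]; rewrite forest_word1.
elim/forest_ind: s => // c r IH; rewrite forest_word_Node /=.
case E: (forest_word (c ++ r)) => [|y w] /=; last by rewrite E in IH.
by have := size_forest_le (c ++ r); rewrite E /= size_cat; lia.
Qed.

Lemma prefix_nseq_cat h (w v : seq nat) :
  last 1%N w = 0%N -> prefix (nseq h 1%N) (w ++ v) -> prefix (nseq h 1%N) w.
Proof.
elim: w h => [|x w IHw] [|h] //=.
move=> lastw /andP[/eqP x1 hw]; rewrite -x1 eqxx /= in lastw *.
exact: IHw.
Qed.

Lemma fringe_subtree_Node c i u :
  (i < size c)%N -> fringe_subtree (Node c) (i :: u) = fringe_subtree (nth
    leaf c i) u.
Proof. by move=> lti /=; rewrite onthE (nth_map leaf). Qed.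

Lemma contains_chainP t h :
  contains_nonfringe t (chain h) <-> infix (nseq h 1%N) (word t).
Proof.
split=> [[u [s [/fringe_subtree_infix st /pruned_chainE/prefixW hs]]]|].
  exact: infix_trans hs st.
case: h => [_|h]; first by exists [::], t; split => //; exact: pruned_cut.
have H f : infix (nseq h.+1 1%N) (forest_word f) ->
    exists2 s, s \in f & contains_nonfringe s (chain h.+1).
  elim/forest_ind: f => [//|c r IH]; rewrite forest_word_Node infix_consl.
  move=> /orP[hc|/IH [s]].
    exists (Node c); first exact: mem_head.
    exists [::], (Node c); split => //; apply/pruned_chainE.
    move: hc; rewrite forest_word_cat -cat_cons -[_ :: _]/(word (Node c)).
    exact/prefix_nseq_cat/last_word.
  rewrite mem_cat => /orP[sc [u [s' [us' s'h]]]|sr hs]; last first.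
    by exists s => //; rewrite inE sr orbT.
  exists (Node c); first exact: mem_head.
  exists (index s c :: u), s'; split=> //.
  by rewrite fringe_subtree_Node ?index_mem // nth_index.
by rewrite -forest_word1 => /H [s]; rewrite inE => /eqP ->.
Qed.

(** * Subexponential lower bound on the mass of trees of a given size *)

Section weights.
Context {R : realType} (p : nat -> R).

Definition weight (s : seq tree) : R := \prod_(d <- forest_word s) p d.

(** The probability that [j] independent Galton-Watson trees have [n] nodes
    altogether.  For [j = 1] this is the mass Z_n of the trees of size [n]. *)
Definition forest_mass (n j : nat) : R := \sum_(s <- forests n j) weight s.

Lemma weight_Node c r : weight (Node c :: r) = p (size c) * weight (c ++ r).
Proof. by rewrite /weight forest_word_Node big_cons. Qed.

Lemma forest_mass00 : forest_mass 0 0 = 1.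
Proof. by rewrite /forest_mass /= big_seq1 /weight big_nil. Qed.

Lemma forest_massS0 n : forest_mass n.+1 0 = 0.
Proof. by rewrite /forest_mass /= big_nil. Qed.

Lemma forest_mass_small n j : (n < j)%N -> forest_mass n j = 0.
Proof.
move=> ltnj; rewrite /forest_mass big_seq big1 // => s.
rewrite mem_forests => /andP[/eqP sz /eqP wd].
by have := size_forest_le s; rewrite sz wd leqNgt ltnj.
Qed.

(** One step of the depth-first exploration.  The range of the degree may be
    any bound from [n] on, which makes the recursion uniform in later sums. *)
Lemma forest_massSS n j N : (n <= N)%N ->
  forest_mass n.+1 j.+1 = \sum_(d < N.+1) p d * forest_mass n (d + j).
Proof.
move=> le_nN.
transitivity (\sum_(d < n.+1) p d * forest_mass n (d + j)).
  rewrite /forest_mass (big_forests _ _ predT); apply: eq_bigr => d _.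
  rewrite mulr_sumr big_seq [RHS]big_seq; apply: eq_bigr => s.
  rewrite mem_forests => /andP[/eqP sz _].
  by rewrite weight_Node cat_take_drop size_takel // sz leq_addr.
rewrite (big_ord_widen N.+1 (fun d => p d * forest_mass n (d + j))) //.
rewrite big_mkcond /=; apply: eq_bigr => d _; case: ifPn => //.
by rewrite -leqNgt => lt_nd; rewrite forest_mass_small ?mulr0 //; lia.
Qed.

Hypothesis p_ge0 : forall d, 0 <= p d.

Lemma weight_ge0 s : 0 <= weight s.
Proof. by apply: prodr_ge0 => d _. Qed.

Lemma forest_mass_ge0 n j : 0 <= forest_mass n j.
Proof. by apply: sumr_ge0 => s _; exact: weight_ge0. Qed.

Lemma forest_mass_mul a b i j :
  forest_mass a i * forest_mass b j <= forest_mass (a + b) (i + j).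
Proof.
elim: a i => [|a IHa] [|i].
- by rewrite forest_mass00 mul1r.
- by rewrite forest_mass_small // mul0r forest_mass_ge0.
- by rewrite forest_massS0 mul0r forest_mass_ge0.
rewrite !addSn (forest_massSS i (leq_addr b a)) (forest_massSS _ (leqnn (a +
  b))).
rewrite mulr_suml; apply: ler_sum => d _.
by rewrite -mulrA ler_wpM2l // addnA.
Qed.

Lemma forest_mass_diag n : p 0 ^+ n <= forest_mass n n.
Proof.
elim: n => [|n IHn]; first by rewrite expr0 forest_mass00.
apply: le_trans (forest_mass_mul 1 n 1 n).
rewrite exprS ler_pM ?exprn_ge0 //.
by rewrite (@forest_massSS 0 0 0) // big_ord1 forest_mass00 mulr1.
Qed.

Lemma forest_mass_child n d : p d * forest_mass n d <= forest_mass n.+1 1.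
Proof.
have [lt_nd|le_dn] := ltnP n d.
  by rewrite forest_mass_small // mulr0 forest_mass_ge0.
rewrite (forest_massSS 0 (leqnn n)) (bigD1 (Ordinal (le_dn : (d < n.+1)%N)))
  //=.
by rewrite addn0 lerDl sumr_ge0 // => k _; rewrite mulr_ge0 ?forest_mass_ge0.
Qed.

(** Two trees and [k - 2] leaves are hung below a common root of degree [k].
    This is the supermultiplicativity of Z_n. *)
Lemma forest_mass_join k a b : (1 < k)%N ->
  p k * p 0 ^+ (k - 2) * forest_mass a 1 * forest_mass b 1 <=
  forest_mass (a + b + k.-1) 1.
Proof.
move=> lt1k; have -> : (a + b + k.-1 = (a + (b + (k - 2))).+1)%N by lia.
apply: le_trans (forest_mass_child _ k); rewrite -!mulrA ler_wpM2l //.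
have -> : forest_mass (a + (b + (k - 2))) k =
    forest_mass (a + (b + (k - 2))) (1 + (1 + (k - 2))) by congr forest_mass;
      lia.
apply: le_trans (forest_mass_mul _ _ _ _);
  rewrite mulrCA ler_wpM2l ?forest_mass_ge0 //.
apply: le_trans (forest_mass_mul _ _ _ _);
  rewrite mulrC ler_wpM2l ?forest_mass_ge0 //.
exact: forest_mass_diag.
Qed.

Lemma forest_mass_unary n : p 0 * p 1 ^+ n <= forest_mass n.+1 1.
Proof.
elim: n => [|n IHn]; first by rewrite mulr1 -[p 0]expr1 forest_mass_diag.
apply: le_trans (forest_mass_child _ 1).
by rewrite exprS mulrCA ler_wpM2l.
Qed.

(** Truncated at size [N], so that all sums are finite and no convergence is
    presupposed. *)
Definition genfun (x : R) (N j : nat) : R :=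
  \sum_(n < N.+1) forest_mass n j * x ^+ n.

Variable x : R.
Hypothesis x_ge0 : 0 <= x.

Lemma genfun_ge0 N j : 0 <= genfun x N j.
Proof.
by apply: sumr_ge0 => n _; rewrite mulr_ge0 ?forest_mass_ge0 ?exprn_ge0.
Qed.

Lemma genfun_homo j : {homo (fun N =>
  genfun x N j) : N M / (N <= M)%N >-> N <= M}.
Proof.
apply: homo_leq (lexx) le_trans _ => N.
rewrite /genfun [leRHS]big_ord_recr /= lerDl.
by rewrite mulr_ge0 ?forest_mass_ge0 ?exprn_ge0.
Qed.

Lemma genfun_0 N : genfun x N 0 = 1.
Proof.
rewrite /genfun big_ord_recl forest_mass00 mulr1 big1 ?addr0 // => n _.
by rewrite forest_massS0 mul0r.
Qed.

Lemma genfunSS N j :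
  genfun x N.+1 j.+1 = x * \sum_(d < N.+1) p d * genfun x N (d + j).
Proof.
rewrite /genfun big_ord_recl forest_mass_small // mul0r add0r.
under eq_bigr => n _ do
  rewrite (@forest_massSS _ _ N) -1?ltnS ?ltn_ord // exprS mulrCA mulr_suml.
rewrite -mulr_sumr exchange_big; congr (_ * _); apply: eq_bigr => d _.
by rewrite mulr_sumr; apply: eq_bigr => n _; rewrite mulrA.
Qed.

(** Juxtaposing forests multiplies generating functions; truncation makes
    this an inequality. *)
Lemma genfun_mul N M i j :
  genfun x N i * genfun x M j <= genfun x (N + M) (i + j).
Proof.
elim: N i => [|N IHN] [|i].
- by rewrite genfun_0 mul1r.
- by rewrite /genfun big_ord1 forest_mass_small // !mul0r genfun_ge0.
- by rewrite genfun_0 mul1r; apply: genfun_homo; rewrite leq_addl.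
rewrite !addSn !genfunSS -mulrA ler_wpM2l // mulr_suml.
rewrite [leRHS](bigID (fun d : 'I__ => (d < N.+1)%N)) /= ler_wpDr //.
  by apply: sumr_ge0 => d _; rewrite mulr_ge0 ?genfun_ge0.
rewrite (big_ord_widen (N + M).+1
  (fun d => p d * genfun x N (d + i) * genfun x M j)) ?ltnS ?leq_addr //.
by apply: ler_sum => d _; rewrite -mulrA ler_wpM2l // addnA.
Qed.

Lemma genfun_exp N k : genfun x N 1 ^+ k <= genfun x (k * N) k.
Proof.
elim: k => [|k IHk]; first by rewrite expr0 genfun_0.
rewrite exprS mulSn -[k.+1]add1n; apply: le_trans (genfun_mul _ _ _ _).
by rewrite ler_wpM2l // genfun_ge0.
Qed.

(** Truncated form of the functional equation Y = x * sum_k p_k Y^k of the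
    generating function of a Galton-Watson tree, keeping only the inequality
    that survives truncation. *)
Lemma genfun_fixpoint N K : (0 < N)%N ->
  x * \sum_(k < K) p k * genfun x N 1 ^+ k <= genfun x (K * N).+1 1.
Proof.
move=> N0; rewrite genfunSS ler_wpM2l //.
have leK : (K <= (K * N).+1)%N by nia.
rewrite (big_ord_widen (K * N).+1 (fun k => p k * genfun x N 1 ^+ k)) //.
rewrite [leRHS](bigID (fun d : 'I__ => (d < K)%N)) /= ler_wpDr //.
  by apply: sumr_ge0 => d _; rewrite mulr_ge0 ?genfun_ge0.
apply: ler_sum => k ltk; rewrite ler_wpM2l // addn0.
by apply: (le_trans (genfun_exp _ _)); rewrite ?genfun_homo //; nia.
Qed.

End weights.

Section critical.
Context {R : realType} (p : nat -> R).
Hypothesis p_ge0 : forall d, 0 <= p d.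
Hypothesis p0_gt0 : 0 < p 0.
Hypothesis p_sum : (\sum_(k < K) p k @[K --> \oo] --> (1 : R))%classic.
Hypothesis p_mean :
  (\sum_(k < K) k%:R * p k @[K --> \oo] --> (1 : R))%classic.

Lemma bernoulli_ineq (y : R) k : 0 <= y -> 1 + k%:R * (y - 1) <= y ^+ k.
Proof.
move=> y0; elim: k => [|k IHk]; first by rewrite mul0r addr0.
have [k0|k0] := lerP (1 + k%:R * (y - 1)) 0.
  apply: le_trans (exprn_ge0 _ y0); rewrite -natr1.
  have : y <= 1.
    rewrite leNgt; apply/negP => y1.
    have : 0 <= k%:R * (y - 1) by rewrite mulr_ge0 // subr_ge0 ltW.
    by lra.
  by lra.
rewrite exprS; apply: (@le_trans _ _ (y * (1 + k%:R * (y - 1)))).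
  have : 0 <= k%:R * (y - 1) ^+ 2 by rewrite mulr_ge0 // sqr_ge0.
  by rewrite -natr1; nra.
by rewrite ler_wpM2l.
Qed.

(** The radius of convergence is 1.  Otherwise the supremum L of the
    truncations would satisfy L >= x * sum_k p_k Y^k for every truncation Y;
    the tangent of Y |-> Y^k at 1 and the criticality of the offspring law turn
    this into L >= x Y, hence L >= x L with L > 0. *)
Lemma genfun_unbounded (x C : R) : 1 < x -> exists N, C < genfun p x N 1.
Proof.
move=> x1; apply: contrapT => /forallNP bd.
have x0 : 0 <= x by lra.
have ub N : genfun p x N 1 <= C by rewrite leNgt; apply/negP.
pose A := range (fun N => genfun p x N 1).
have supA : has_sup A.
  by split; [exists (genfun p x 0 1), 0%N|exists C => _ [N _ <-]; exact: ub].
pose L := sup A.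
have leL N : genfun p x N 1 <= L.
  by apply: ub_le_sup; [exact: supA.2|exists N].
have stepL N : (0 < N)%N -> x * genfun p x N 1 <= L.
  move=> N0; set y := genfun p x N 1.
  have y0 : 0 <= y by exact: genfun_ge0.
  have cv : (x * (\sum_(k < K) p k + (y - 1) * \sum_(k < K) k%:R * p k)
      @[K --> \oo] --> x * (1 + (y - 1) * 1))%classic.
    by apply: cvgMl_tmp; apply: cvgD => //; exact: cvgMl_tmp.
  have -> : x * y = x * (1 + (y - 1) * 1) by lra.
  apply: (ler_cvg_to cv (cvg_cst L)); near=> K.
  apply: le_trans (leL (K * N).+1);
    apply: le_trans (genfun_fixpoint _ _ _ _) => //.
  rewrite ler_wpM2l // mulr_sumr -big_split /=; apply: ler_sum => k _.
  have -> : p k + (y - 1) * (k%:R * p k) = p k * (1 + k%:R * (y - 1)) by lra.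
  by rewrite ler_wpM2l // bernoulli_ineq.
have L0 : 0 < L.
  apply: lt_le_trans (leL 1%N); apply: (@lt_le_trans _ _ (p 0 * x)).
    by rewrite mulr_gt0 //; lra.
  rewrite /genfun big_ord_recl /= forest_mass_small // mul0r add0r big_ord1 /=
    expr1.
  by rewrite ler_wpM2r // -[p 0]expr1 forest_mass_diag.
have : L <= L / x.
  apply: ge_sup; first exact: supA.1.
  move=> _ [N _ <-]; rewrite ler_pdivlMr; last by lra.
  rewrite mulrC; case: N => [|N]; last exact: stepL.
  by rewrite /genfun big_ord1 forest_mass_small // mul0r mulr0 ltW.
rewrite ler_pdivlMr; last by lra.
by rewrite ger_pMr //; lra.
Unshelve. all: by end_near. Qed.

(** A bound on the coefficients at [x] would make the generating function
    converge at every point between 1 and [x]. *)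
Lemma tree_mass_large (x C : R) : 1 < x ->
  exists n, C < forest_mass p n 1 * x ^+ n.
Proof.
move=> x1; apply: contrapT => /forallNP bd.
have ub n : forest_mass p n 1 * x ^+ n <= C by rewrite leNgt; apply/negP.
(* The generating function is evaluated at y, halfway between 1 and x. *)
pose y := (1 + x) / 2; pose r := y / x.
have r1 : r < 1 by rewrite ltr_pdivrMr /y; lra.
have r0 : 0 < r by rewrite divr_gt0 /y; lra.
have C0 : 0 <= C.
  by apply: le_trans (ub 0%N); rewrite mulr_ge0 ?forest_mass_ge0.
have [|N] := @genfun_unbounded y (C / (1 - r)); first by rewrite /y; lra.
apply/negP; rewrite -leNgt /genfun.
rewrite ler_pdivlMr; last by lra.
apply: (@le_trans _ _ ((\sum_(n < N.+1) C * r ^+ n) * (1 - r))).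
  rewrite ler_wpM2r; first by [].
    by lra.
  apply: ler_sum => n _.
  have -> : y ^+ n = x ^+ n * r ^+ n by rewrite -exprMn /r mulrC divfK //; lra.
  by rewrite mulrA ler_wpM2r // exprn_ge0 // ltW.
rewrite -mulr_sumr -mulrA [_ * (1 - r)]mulrC -[1 - r]opprB mulNr -subrX1 opprB.
by rewrite ler_piMr // lerBlDr lerDl exprn_ge0 // ltW.
Qed.

(** One size [n0] with a large term suffices: joining with a tree of size [n0]
    below a vertex of degree [k] increases the size by [n0 + k - 1] without
    decreasing Z_n x^n, and the sizes below this period are reached by paths of
    unary nodes. *)
Lemma forest_mass_subexp (x : R) k : 1 < x -> (1 < k)%N -> 0 < p k -> 0 < p 1 ->
  p 1 <= 1 ->
  exists2 c, 0 < c & forall n, (0 < n)%N -> c <= forest_mass p n 1 * x ^+ n.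
Proof.
move=> x1 k1 pk p1 p1le.
pose kap := p k * p 0 ^+ (k - 2).
have kap0 : 0 < kap by rewrite mulr_gt0 // exprn_gt0.
have [n0 large] := tree_mass_large kap^-1 x1.
(* M is the increase of the size under joining with a tree of size n0. *)
pose M := (n0 + k.-1)%N.
exists (p 0 * p 1 ^+ M); first by rewrite mulr_gt0 // exprn_gt0.
move=> n; have [m] := ubnP n; elim: m n => // m IHm n; rewrite ltnS => lenm n0'.
have x0 : 0 < x by lra.
have [lenM|ltMn] := leqP n M.
  case: n n0' lenM {lenm} => // n _ ltnM.
  apply: (@le_trans _ _ (forest_mass p n.+1 1)).
    apply: le_trans (forest_mass_unary _ _) => //.
    by rewrite ler_wpM2l ?(ltW p0_gt0) // ler_wiXn2l // ltnW.
  by rewrite ler_peMr ?forest_mass_ge0 // exprn_ege1 // ltW.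
have -> : (n = n0 + (n - M) + k.-1)%N by rewrite /M in ltMn *; lia.
apply: (@le_trans _ _ (forest_mass p (n - M) 1 * x ^+ (n - M))).
  by apply: IHm; rewrite /M in ltMn *; lia.
apply: (@le_trans _ _ ((kap * forest_mass p n0 1 * forest_mass p (n - M) 1)
   * x ^+ (n0 + (n - M)))).
  rewrite exprD [leRHS](_ : _ = (kap * (forest_mass p n0 1 * x ^+ n0)) *
    (forest_mass p (n - M) 1 * x ^+ (n - M))); last by ring.
  rewrite ler_peMl ?mulr_ge0 ?forest_mass_ge0 ?exprn_ge0 ?(ltW x0) //.
  by rewrite mulrC -ler_pdivrMr // mul1r ltW.
apply: ler_pM; rewrite ?mulr_ge0 ?forest_mass_ge0 ?exprn_ge0 ?(ltW x0) ?(ltW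
  kap0) //.
  exact: forest_mass_join.
by rewrite ler_weXn2l ?leq_addr // ltW.
Qed.
End critical.

(** * Erasing the unary nodes *)

Section unary_patterns.
Context {R : realType} (p : nat -> R).

Definition unary_pattern (s : seq tree) : seq bool :=
  [seq d == 1%N | d <- forest_word s].

Definition pattern_mass (b : seq bool) (j : nat) : R :=
  \sum_(s <- forests (size b) j | unary_pattern s == b) weight p s.

Lemma pattern_mass_nil : pattern_mass [::] 0 = 1.
Proof.
by rewrite /pattern_mass /= big_mkcond big_seq1 /unary_pattern /weight big_nil.
Qed.

Lemma pattern_mass_cons0 c b : pattern_mass (c :: b) 0 = 0.
Proof. by rewrite /pattern_mass /= big_nil. Qed.

Lemma pattern_mass_small b j : (size b < j)%N -> pattern_mass b j = 0.
Proof.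
move=> ltbj; rewrite /pattern_mass big_seq_cond big1 // => s.
rewrite mem_forests => /andP[/andP[/eqP sz /eqP wd] _].
by have := size_forest_le s; rewrite sz wd leqNgt ltbj.
Qed.

Lemma pattern_mass_cons c b j N : (size b <= N)%N ->
  pattern_mass (c :: b) j.+1 =
  \sum_(d < N.+1 | (val d == 1%N) == c) p d * pattern_mass b (d + j).
Proof.
move=> leN.
transitivity (\sum_(d < (size b).+1 | (val d == 1%N) == c)
    p d * pattern_mass b (d + j)).
  rewrite /pattern_mass [size (c :: b)]/= big_forests [RHS]big_mkcond.
  apply: eq_bigr => d _; rewrite mulr_sumr big_seq_cond.
  have E s : s \in forests (size b) (d + j) ->
      (unary_pattern (Node (take d s) :: drop d s) == c :: b) =
      ((val d == 1%N) == c) && (unary_pattern s == b).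
    rewrite mem_forests => /andP[/eqP sz _].
    rewrite /unary_pattern forest_word_Node /= eqseq_cons cat_take_drop.
    by rewrite size_takel // sz leq_addr.
  case: ifPn => dc; last first.
    by rewrite big1 // => s /andP[/E ->]; rewrite (negbTE dc).
  rewrite [RHS]big_seq_cond; apply: eq_big => [s|s /andP[]].
    by case sF: (s \in _) => //=; rewrite E // dc.
  rewrite mem_forests => /andP[/eqP sz _] _.
  by rewrite weight_Node cat_take_drop size_takel // sz leq_addr.
rewrite (big_ord_widen_cond N.+1 (fun d => (d == 1%N) == c)
  (fun d => p d * pattern_mass b (d + j))) //.
rewrite big_mkcondr /=; apply: eq_bigr => d _; case: ifPn => //.
by rewrite -leqNgt => lt_bd; rewrite pattern_mass_small ?mulr0 //; lia.
Qed.

(** A unary root is replaced by its child, so the number of trees is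
    unchanged. *)
Lemma pattern_mass_true b j :
  pattern_mass (true :: b) j.+1 = p 1 * pattern_mass b j.+1.
Proof.
rewrite (pattern_mass_cons _ _ (leqnSn (size b))).
by rewrite (big_pred1 (Ordinal (isT : (1 < (size b).+2)%N))) // => d;
  rewrite eqb_id.
Qed.

(** Erasing the letters 1 only costs a factor [p 1] for each.  The final mark
    [false] matters: a word cannot end with a letter 1, and without a last
    letter kept in place the erased word could already be complete before the
    remaining letters 1 are read. *)
Lemma pattern_mass_erase b j :
  pattern_mass (rcons b false) j =
  p 1 ^+ count id b * pattern_mass (nseq (count negb b).+1 false) j.
Proof.
elim: b j => [|c b IHb] j; first by rewrite mul1r.
case: j => [|j]; first by rewrite /= !pattern_mass_cons0 mulr0.
case: c => /=; first by rewrite pattern_mass_true IHb exprS mulrA add0n.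
rewrite add0n !(@pattern_mass_cons false _ j (size b).+1) ?size_rcons //;
  last first.
  by rewrite /= size_nseq ltnS count_size.
by rewrite mulr_sumr; apply: eq_bigr => d _; rewrite IHb mulrCA.
Qed.

Hypothesis p_ge0 : forall d, 0 <= p d.
Hypothesis p_le1 : forall K, \sum_(k < K) p k <= 1.

(** The weights of the letters other than 1 add up to at most [1 - p 1]; this
    is the source of the factor [(1 - p 1) ^+ m] in [pattern_mass_le]. *)
Lemma nonunary_mass_le K : \sum_(k < K | val k != 1%N) p k <= 1 - p 1.
Proof.
rewrite lerBrDr; apply: le_trans (p_le1 K.+2).
rewrite (bigD1 (Ordinal (isT : (1 < K.+2)%N))) //= addrC lerD2r.
rewrite (big_ord_widen_cond K.+2 (fun k => k != 1%N) p); last by lia.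
by rewrite big_mkcondr; apply: ler_sum => k _; case: ifP.
Qed.

Lemma p1_le1 : p 1 <= 1.
Proof.
have := nonunary_mass_le 0; rewrite big_ord0; lra.
Qed.

Lemma pattern_mass_ge0 b j : 0 <= pattern_mass b j.
Proof. by apply: sumr_ge0 => s _; exact: weight_ge0. Qed.

Lemma pattern_mass_le m j : pattern_mass (nseq m false) j <= (1 - p 1) ^+ m.
Proof.
elim: m j => [|m IHm] [|j].
- by rewrite pattern_mass_nil.
- by rewrite pattern_mass_small.
- by rewrite /= pattern_mass_cons0 exprn_ge0 // subr_ge0 p1_le1.
rewrite /= (pattern_mass_cons _ _ (leqnn _)) exprS.
apply: le_trans (ler_wpM2r _ (nonunary_mass_le (size (nseq m false)).+1));
  last first.
  by rewrite exprn_ge0 // subr_ge0 p1_le1.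
rewrite mulr_suml [leLHS](eq_bigl (fun d : 'I__ => val d != 1%N)); last first.
  by move=> d; rewrite eqbF_neg.
by apply: ler_sum => d _; rewrite ler_wpM2l.
Qed.

End unary_patterns.

Lemma card_ksets_sub N k (B : pred {set 'I_N}) :
  (#|[set S : {set 'I_N} | B S && (#|S| == k)]| <= 'C(N, k))%N.
Proof.
have -> : 'C(N, k) = #|[set S : {set 'I_N} | #|S| == k]| by rewrite card_draws
  card_ord.
by apply: subset_leq_card; apply/fintype.subsetP => S; rewrite !inE => /andP[].
Qed.

Section positions.
Context {R : realType} (p : nat -> R).
Hypothesis p_ge0 : forall d, 0 <= p d.
Hypothesis p_le1 : forall K, \sum_(k < K) p k <= 1.
Variable N : nat.

Definition unary_positions (s : seq tree) : {set 'I_N} :=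
  [set i : 'I_N | nth 0%N (forest_word s) i == 1%N].

(** The marks of the first [N] letters.  A tree with [N.+1] nodes has a word of
    length [N.+1] whose last letter is 0, so that only [N] positions can carry a
    letter 1. *)
Definition bits (S : {set 'I_N}) : seq bool := [seq i \in S | i <- enum 'I_N].

Lemma size_bits S : size (bits S) = N.
Proof. by rewrite size_map size_enum_ord. Qed.

Lemma count_bits S : count id (bits S) = #|S|.
Proof.
by rewrite count_map cardE -size_filter enumT.
Qed.

Lemma count_bitsC S : count negb (bits S) = (N - #|S|)%N.
Proof.
have : (count id (bits S) + count negb (bits S) = size (bits S))%N.
  exact: count_predC.
by rewrite size_bits count_bits; move: (count _ _) #|S| => a b; lia.
Qed.

Lemma bits_inj : injective bits.
Proof.
move=> S S' /eq_in_map SS'; apply/setP => i; apply: SS'; exact: mem_enum.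
Qed.

Lemma unary_patternE s : s \in forests N.+1 1 ->
  unary_pattern s = rcons (bits (unary_positions s)) false.
Proof.
rewrite mem_forests; case: s => [|t [|t' s]] //; rewrite /= => /eqP szw.
have lw := last_word t 0%N; rewrite forest_word1 in szw.
apply: (@eq_from_nth _ false) => [|i].
  by rewrite size_map size_rcons size_bits forest_word1.
rewrite size_map forest_word1 szw => ltiN.
rewrite nth_rcons size_bits (nth_map 0%N) ?forest_word1 ?szw //.
case: (ltngtP i N) ltiN => [ltiN _|ltNi|-> _]; last 2 first.
- by rewrite ltnS leqNgt ltNi.
- by rewrite -[N]/(N.+1.-1) -szw nth_last lw.
rewrite (nth_map (Ordinal ltiN)) ?size_enum_ord // inE nth_enum_ord //.
by rewrite forest_word1.
Qed.

(** The total weight of the reduced words of length [m.+1], the last of these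
    letters being the one that closes the tree. *)
Definition nonunary_mass (m : nat) : R := pattern_mass p (nseq m.+1 false) 1.

(** The mass of a set of positions depends on its cardinal only: given their
    number, the unary nodes sit at uniformly distributed positions. *)
Lemma positions_mass (S : {set 'I_N}) :
  \sum_(s <- forests N.+1 1 | unary_positions s == S) weight p s =
  p 1 ^+ #|S| * nonunary_mass (N - #|S|).
Proof.
rewrite -count_bitsC -count_bits -pattern_mass_erase /pattern_mass.
rewrite size_rcons size_bits big_seq_cond [RHS]big_seq_cond.
apply: eq_bigl => s; case sF: (s \in _) => //=.
by rewrite unary_patternE // eqseq_rcons eqxx andbT (inj_eq bits_inj).
Qed.

Lemma sum_card (B : pred {set 'I_N}) (F : nat -> R) :
  \sum_(S : {set 'I_N} | B S) F #|S| =
  \sum_(k < N.+1) #|[set S : {set 'I_N} | B S && (#|S| == k)]|%:R * F k.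
Proof.
have ltN (S : {set 'I_N}) : (#|S| < N.+1)%N.
  by rewrite ltnS -[leqRHS]card_ord max_card.
rewrite (partition_big (fun S => Ordinal (ltN S)) predT) //=.
apply: eq_bigr => k _; rewrite (eq_bigr (fun=> F k)); last first.
  by move=> S /andP[_ /eqP <-].
rewrite sumr_const mulr_natl; congr (_ *+ _).
by apply: eq_card => S; rewrite !inE.
Qed.

Lemma tree_mass_positions :
  forest_mass p N.+1 1 = \sum_(k < N.+1) 'C(N, k)%:R * (p 1 ^+ k *
    nonunary_mass (N - k)).
Proof.
rewrite /forest_mass (partition_big unary_positions predT) //=.
rewrite (eq_bigr (fun S : {set 'I_N} =>
  p 1 ^+ #|S| * nonunary_mass (N - #|S|))); last first.
  by move=> S _; exact: positions_mass.
rewrite (sum_card predT (fun k => p 1 ^+ k * nonunary_mass (N - k))).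
apply: eq_bigr => k _; congr (_%:R * _).
have -> : 'C(N, k) = #|[set S : {set 'I_N} | #|S| == k]| by rewrite card_draws
  card_ord.
by apply: eq_card => S; rewrite !inE.
Qed.

(** Splitting according to the number k of unary nodes.  For k in the window
    [W] uniformity turns a bound on the proportion of k-subsets into a bound on
    the proportion of mass; outside, the reduced words weigh at most
    [(1 - p 1) ^+ (N - k)] and a binomial tail appears. *)
Lemma mass_le_positions (A : pred (seq tree)) (B : pred {set 'I_N}) (W : pred
  nat) (e : R) :
  (forall s, s \in forests N.+1 1 -> A s -> B (unary_positions s)) ->
  (forall k, W k -> #|[set S : {set 'I_N} | B S && (#|S| == k)]|%:R <=
    e * 'C(N, k)%:R) ->
  0 <= e ->
  \sum_(s <- forests N.+1 1 | A s) weight p s <=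
    e * forest_mass p N.+1 1 +
    \sum_(k < N.+1 | ~~ W k) 'C(N, k)%:R * (p 1 ^+ k * (1 - p 1) ^+ (N - k)).
Proof.
move=> AB Bcard e0.
have p1 : 0 <= 1 - p 1 by rewrite subr_ge0 p1_le1.
have nm0 m : 0 <= nonunary_mass m by exact: pattern_mass_ge0.
have -> : \sum_(s <- forests N.+1 1 | A s) weight p s =
    \sum_(s <- forests N.+1 1 | (s \in forests N.+1 1) && A s) weight p s.
  by rewrite big_seq_cond.
rewrite (partition_big unary_positions B) /=; last by move=> s /andP[];
  exact: AB.
apply: (@le_trans _ _ (\sum_(S : {set 'I_N} | B S) p 1 ^+ #|S| * nonunary_mass
  (N - #|S|))).
  apply: ler_sum => S _; rewrite -positions_mass [leLHS]big_mkcond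
    [leRHS]big_mkcond.
  apply: ler_sum => s _; case: ifP => [/andP[_ ->] //|_].
  by case: ifP => // _; exact: weight_ge0.
rewrite (sum_card B (fun k => p 1 ^+ k * nonunary_mass (N - k))).
rewrite (bigID (fun k : 'I__ => W k)) /= lerD //.
  rewrite tree_mass_positions mulr_sumr big_mkcond; apply: ler_sum => k _.
  case: ifP => [Wk|_]; last by rewrite !mulr_ge0 ?exprn_ge0.
  by rewrite [leRHS]mulrA ler_wpM2r ?mulr_ge0 ?exprn_ge0 ?Bcard.
apply: ler_sum => k _; apply: ler_pM; rewrite ?mulr_ge0 ?exprn_ge0 //.
  by rewrite ler_nat card_ksets_sub.
rewrite ler_wpM2l ?exprn_ge0 //;
  apply: le_trans (pattern_mass_le _ _ _ _) _ => //.
by rewrite exprS ler_piMl ?exprn_ge0 // lerBlDr lerDl.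
Qed.

End positions.

(** * Runs in a uniformly random k-subset of an interval *)

Section second_moment.
Context {R : realFieldType} (T : finType) (r : nat) (U : {set T}) (A : 'I_r ->
  {set T}).
Variables a b : R.
Hypothesis card1 : forall i, #|U :&: A i|%:R = a.
Hypothesis card2 : forall i j, i != j -> #|U :&: A i :&: A j|%:R <= b.
Hypothesis ab : b * #|U|%:R <= a ^+ 2.

(** Chebyshev's inequality for the number of events [A i] that hold at a
    uniformly random point of [U].  As [b * #|U| <= a ^+ 2], these events are
    pairwise negatively correlated, so the variance is at most the mean. *)
Lemma second_moment : #|U :\: \bigcup_i A i|%:R * (r%:R * a) <= #|U|%:R ^+ 2.
Proof.
pose t : R := #|U|%:R.
pose c S : R := \sum_(i < r) (S \in A i)%:R.
have t0 : 0 <= t by exact: ler0n.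
have indic (W : {set T}) : \sum_(S in U) (S \in W)%:R = #|U :&: W|%:R :> R.
  rewrite -sum1_card natr_sum [RHS](eq_bigl (fun S =>
    (S \in U) && (S \in W))); last first.
    by move=> S; rewrite inE.
  by rewrite big_mkcondr; apply: eq_bigr => S _; case: (S \in W).
have sumc : \sum_(S in U) c S = r%:R * a.
  rewrite exchange_big /= -[r in RHS]card_ord mulr_natl -sumr_const.
  by apply: eq_bigr => i _; rewrite indic card1.
have sumc2 : \sum_(S in U) c S ^+ 2 <= r%:R * a + r%:R * (r%:R - 1) * b.
  have -> : \sum_(S in U) c S ^+ 2 =
      \sum_(i < r) \sum_(j < r) \sum_(S in U) ((S \in A i) && (S \in A j))%:R.
    under [RHS]eq_bigr => i _ do rewrite exchange_big /=.
    rewrite exchange_big /=; apply: eq_bigr => S _.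
    rewrite expr2 mulr_suml; apply: eq_bigr => i _.
    by rewrite mulr_sumr; apply: eq_bigr => j _; rewrite -natrM mulnb.
  apply: (@le_trans _ _ (\sum_(i < r) (a + (r%:R - 1) * b))); last first.
    by rewrite sumr_const card_ord -mulr_natl; lra.
  apply: ler_sum => i _; rewrite (bigD1 i) //= lerD //.
    under eq_bigr => S _ do rewrite andbb.
    by rewrite indic card1.
  apply: (@le_trans _ _ (\sum_(j < r | j != i) b)).
    apply: ler_sum => j ji; apply: le_trans (card2 (_ : i != j));
      last by rewrite eq_sym.
    rewrite -finset.setIA -indic; apply: ler_sum => S _; by rewrite inE.
  rewrite sumr_const -[b *+ _]mulr_natl (_ : #|_|%:R = r%:R - 1 :> R) //.
  have := cardC (pred1 i); rewrite fintype.card1 card_ord => cardr.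
  have -> : r%:R - 1 = #|predC (pred1 i)|%:R :> R.
    by rewrite -[X in X%:R - 1]cardr natrD addrC addKr.
  by congr _%:R; apply: eq_card.
have [r0|r0] := posnP r.
  by rewrite [X in X * a](_ : _ = 0) ?r0 // mul0r mulr0 sqr_ge0.
have r1 : 1 <= r%:R :> R by rewrite ler1n.
have a0 : 0 <= a by rewrite -(card1 (Ordinal r0)) ler0n.
have [->|an0] := eqVneq a 0; first by rewrite mulr0 mulr0 sqr_ge0.
have apos : 0 < a by rewrite lt_def an0.
set nu : R := #|_ :\: _|%:R.
have cheb : nu * (r%:R * a) ^+ 2 <= \sum_(S in U) (c S * t - r%:R * a) ^+ 2.
  rewrite /nu -sum1_card natr_sum mulr_suml big_mkcond [leRHS]big_mkcond /=.
  apply: ler_sum => S _; rewrite inE; case: (S \in U); rewrite ?andbF //= andbT.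
  case: ifPn => [nS|_]; last exact: sqr_ge0.
  rewrite mul1r /c big1 ?mul0r ?sub0r ?sqrrN // => i _.
  case SA: (S \in A i) => //; case/finset.bigcupP: nS; by exists i.
have expand : \sum_(S in U) (c S * t - r%:R * a) ^+ 2 =
    t ^+ 2 * (\sum_(S in U) c S ^+ 2) - 2 * t * r%:R * a * (\sum_(S in U) c S)
    + r%:R ^+ 2 * a ^+ 2 * t.
  rewrite [X in _ + _ * X](_ : t = \sum_(S in U) 1);
    last by rewrite /t -sum1_card natr_sum.
  rewrite !mulr_sumr -sumrN -!big_split /=; apply: eq_bigr => S _.
  by rewrite mulr1; ring.
rewrite expand sumc in cheb.
have bt : t * (b * t) <= t * a ^+ 2 by rewrite ler_wpM2l.
have rr : 0 <= r%:R * (r%:R - 1) :> R by rewrite mulr_ge0 // subr_ge0.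
have : nu * (r%:R * a) * (r%:R * a) <= t ^+ 2 * (r%:R * a).
  have h1 : t ^+ 2 * (\sum_(S in U) c S ^+ 2) <=
      t ^+ 2 * (r%:R * a + r%:R * (r%:R - 1) * b) by rewrite ler_wpM2l ?sqr_ge0.
  have h2 : r%:R * (r%:R - 1) * (t * (b * t)) <=
    r%:R * (r%:R - 1) * (t * a ^+ 2).
    by rewrite ler_wpM2l.
  have h3 : 0 <= r%:R * (t * a ^+ 2) by rewrite !mulr_ge0 // ?sqr_ge0 // ltW.
  by lra.
by rewrite ler_pM2r // mulr_gt0 //; lra.
Qed.
End second_moment.

Section runs.
Context {R : realFieldType}.
Variables (N k : nat).

Lemma card_supersets (D : {set 'I_N}) : (#|D| <= k)%N ->
  #|[set S : {set 'I_N} | (D \subset S) && (#|S| == k)]| = 'C(N - #|D|, k -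
    #|D|).
Proof.
move=> leDk.
have cardC : (#|~: D| = N - #|D|)%N by have := cardsC D; rewrite card_ord; lia.
rewrite -cardC -cards_draws -[RHS](@card_in_imset _ _ (fun S => D :|: S));
  last first.
  move=> S S'; rewrite !inE => /andP[SD _] /andP[SD' _] E.
  have HD (V : {set 'I_N}) : V \subset ~: D -> (D :|: V) :\: D = V.
    move=> /fintype.subsetP VD; apply/setP => i; rewrite !inE.
    case: (boolP (i \in V)) => [iV|_]; last by rewrite orbF andNb.
    by have := VD i iV; rewrite inE orbT andbT.
  by have := congr1 (fun V => V :\: D) E; rewrite /= !HD.
apply: eq_card => S; rewrite inE; apply/idP/imsetP.
  move=> /andP[DS /eqP cS]; exists (S :\: D).
    rewrite inE; apply/andP; split.
      by apply/fintype.subsetP => i; rewrite !inE => /andP[].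
    by rewrite cardsD (finset.setIidPr DS) cS.
  by rewrite -{1}(finset.setIidPr DS) finset.setID.
move=> [V]; rewrite inE => /andP[VD /eqP cV] ->; rewrite finset.subsetUl /=.
have DV : D :&: V = finset.set0.
  apply/setP => i; rewrite !inE; apply/negbTE/negP => /andP[iD iV].
  by move/fintype.subsetP/(_ _ iV): VD; rewrite inE iD.
by rewrite cardsU DV finset.cards0 subn0 cV subnKC.
Qed.

Definition block (a h : nat) : {set 'I_N} := [set i : 'I_N | (a <=
  i < a + h)%N].

Lemma card_block a h : (a + h <= N)%N -> #|block a h| = h.
Proof.
move=> le_ahN.
have lt (i : 'I_h) : (a + i < N)%N by have := ltn_ord i; lia.
rewrite -[RHS]card_ord -[RHS]cardsT -(@card_imset _ _ (fun i =>
  Ordinal (lt i))); last first.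
  by move=> i j [/addnI]; exact: val_inj.
apply: eq_card => i; rewrite inE; apply/idP/imsetP.
  move=> /andP[lea ltah]; have lti : (i - a < h)%N by lia.
  by exists (Ordinal lti) => //; apply: val_inj => /=; lia.
by move=> [j _ ->] /=; have := ltn_ord j; lia.
Qed.

Definition has_run (h : nat) (S : {set 'I_N}) : bool :=
  [exists a : 'I_N.+1, (a + h <= N)%N && (block a h \subset S)].

Hypothesis le_kN : (k <= N)%N.

Lemma binomial_dropS i : (i < k)%N ->
  ('C(N - i.+1, k - i.+1) * (N - i) = (k - i) * 'C(N - i, k - i))%N.
Proof.
move=> ltik; have := mul_bin_diag (N - i) (k - i).-1.
by rewrite prednK ?subn_gt0 // -!subnS mulnC.
Qed.

(** The probability that a uniform k-subset of N points contains h given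
    points is the product of the ratios (k - i) / (N - i) for i < h, each of
    which lies between (k - h) / N and k / N. *)
Lemma binomial_drop h : (h <= k)%N ->
  ('C(N - h, k - h) * N ^ h <= k ^ h * 'C(N, k))%N /\
  ((k - h) ^ h * 'C(N, k) <= 'C(N - h, k - h) * N ^ h)%N.
Proof.
elim: h => [|h IHh] lthk; first by rewrite !subn0 !expn0 !muln1 !mul1n.
have [U L] := IHh (ltnW lthk); have S := binomial_dropS lthk; split.
  have N0 : (0 < N - h)%N by lia.
  rewrite -(leq_pmul2r N0) !expnS.
  have : ((k - h) * N <= k * (N - h))%N by nia.
  move: U S; set b := 'C(N - h.+1, _); set b1 := 'C(N - h, _);
    set c := 'C(N, k).
  set nh := (N ^ h)%N; set kh := (k ^ h)%N => U S H.
  rewrite mulnAC S mulnACA; apply: (@leq_trans (k * (N - h) * (kh * c))).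
    exact: leq_mul.
  by rewrite mulnACA [((N - h) * c)%N]mulnC mulnA.
have N0 : (0 < N - h)%N by lia.
have mono : ((k - h.+1) ^ h <= (k - h) ^ h)%N.
  by case: (h) => // m; rewrite leq_exp2r //; lia.
rewrite -(leq_pmul2r N0) !expnS.
have : ((k - h.+1) * (N - h) <= (k - h) * N)%N by nia.
move: L S mono; set b := 'C(N - h.+1, _); set b1 := 'C(N - h, _);
  set c := 'C(N, k).
set nh := (N ^ h)%N; set kh := ((k - h) ^ h)%N;
  set kh1 := ((k - h.+1) ^ h)%N => L S mono H.
rewrite [leqRHS]mulnAC S [leqRHS]mulnACA.
apply: (@leq_trans ((k - h.+1) * (N - h) * (kh * c))); last exact: leq_mul.
by rewrite [leqRHS]mulnACA [((N - h) * c)%N]mulnC mulnA !leq_mul2r leq_mul2l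
  mono !orbT.
Qed.

(** Negative correlation of disjoint blocks: the ratios (k - i) / (N - i)
    decrease in i. *)
Lemma binomial_drop_sub h j : (h + j <= k)%N ->
  ('C(N - (h + j), k - (h + j)) * 'C(N, k) <=
   'C(N - h, k - h) * 'C(N - j, k - j))%N.
Proof.
elim: j => [|j IHj]; first by rewrite addn0 !subn0.
rewrite addnS => lthj; have IH := IHj (ltnW lthj).
have S1 := binomial_dropS lthj.
have S2 : ('C(N - j.+1, k - j.+1) * (N - j) = (k - j) * 'C(N - j, k - j))%N.
  by apply: binomial_dropS; lia.
have N1 : (0 < (N - (h + j)) * (N - j))%N by rewrite muln_gt0; lia.
rewrite -(leq_pmul2r N1).
have : ((k - (h + j)) * (N - j) <= (k - j) * (N - (h + j)))%N by nia.
move: IH S1 S2; set b := 'C(N - (h + j).+1, _); set b1 := 'C(N - (h + j), _).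
set c := 'C(N, k); set a := 'C(N - h, _); set d := 'C(N - j.+1, _).
set d1 := 'C(N - j, _) => IH S1 S2 H.
move: S1 S2 H; move: (N - (h + j))%N (k - (h + j))%N (N - j)%N (k - j)%N.
move=> u v w z S1 S2 H; have {}IH := leq_mul H IH.
rewrite mulnACA S1 [leqRHS]mulnACA S2.
have -> : (v * b1 * (c * w) = v * w * (b1 * c))%N by lia.
by have -> : (a * u * (z * d1) = z * u * (a * d1))%N by lia.
Qed.

Definition ksets : {set {set 'I_N}} := [set S : {set 'I_N} | #|S| == k].

Lemma card_ksets : #|ksets| = 'C(N, k).
Proof. by rewrite card_draws card_ord. Qed.

(** Union bound over the starting point of the run. *)
Lemma card_run_le h : (0 < N)%N ->
  #|[set S : {set 'I_N} | has_run h S && (#|S| == k)]|%:R <=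
  N.+1%:R * (k%:R / N%:R) ^+ h * 'C(N, k)%:R :> R.
Proof.
move=> N0; have N0' : 0 < N%:R :> R by rewrite ltr0n.
apply: (@le_trans _ _ (\sum_(a < N.+1) (k%:R / N%:R) ^+ h * 'C(N, k)%:R));
  last first.
  by rewrite sumr_const card_ord -mulrA -[leLHS]mulr_natl.
apply: (@le_trans _ _ (\sum_(a < N.+1)
    #|[set S : {set 'I_N} | (a + h <=
      N)%N && (block a h \subset S) && (#|S| == k)]|%:R)).
  rewrite -natr_sum ler_nat.
  pose E (a : 'I_N.+1) : {set {set 'I_N}} :=
    [set S : {set 'I_N} | (a + h <=
      N)%N && (block a h \subset S) && (#|S| == k)].
  apply: (@leq_trans #|\bigcup_(a < N.+1) E a|).
    apply: subset_leq_card; apply/fintype.subsetP => S; rewrite !inE.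
    move=> /andP[/existsP[a ra] cS]; apply/finset.bigcupP; exists a => //.
    by rewrite inE ra cS.
  rewrite -/(E _); elim/big_rec2: _ => [|a m V _ le_m]; first by rewrite cards0.
  by apply: (leq_trans (leq_card_setU _ _).1); rewrite leq_add2l.
apply: ler_sum => a _; have [leah|_] := leqP (a + h)%N N; last first.
  rewrite (_ : [set _ | _] = finset.set0) ?cards0; last by apply/setP => S;
    rewrite !inE.
  by rewrite mulr_ge0 // exprn_ge0 // divr_ge0.
have [lehk|ltkh] := leqP h k.
  have := @card_supersets (block a h); rewrite card_block // => /(_ lehk) -> /=.
  rewrite expr_div_n mulrAC ler_pdivlMr ?exprn_gt0 // -!natrX -!natrM ler_nat.
  by have [] := binomial_drop lehk.
rewrite (_ : [set _ | _] = finset.set0) ?cards0; last first.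
  apply/setP => S; rewrite !inE;
    apply/negbTE/negP => /andP[/subset_leq_card le /eqP cS].
  by move: le; rewrite card_block // cS leqNgt ltkh.
by rewrite mulr_ge0 // exprn_ge0 // divr_ge0.
Qed.

(** Second moment method for the [r] disjoint blocks that start at the
    multiples of [h]. *)
Lemma card_norun_le h r : (r * h <= N)%N -> (2 * h <= k)%N ->
  #|[set S : {set 'I_N} | ~~ has_run h S && (#|S| == k)]|%:R *
    (r%:R * ((k - h)%:R / N%:R) ^+ h) <= 'C(N, k)%:R :> R.
Proof.
move=> rhN hk.
have [N0|N0] := posnP N.
  have h0 : h = 0%N by lia.
  rewrite (_ : [set _ | _] = finset.set0) ?cards0 ?mul0r //.
  apply/setP => S; rewrite !inE h0; apply/negbTE/negP => /andP[/existsP[]].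
  exists ord0; apply/fintype.subsetP => i; have := ltn_ord i; lia.
pose A (i : 'I_r) : {set {set 'I_N}} :=
  [set S : {set 'I_N} | block (i * h) h \subset S].
have fit (i : 'I_r) : (i * h + h <= N)%N.
  by apply: leq_trans rhN; rewrite -mulSnr leq_mul2r ltn_ord orbT.
have cardA i : #|ksets :&: A i|%:R = 'C(N - h, k - h)%:R :> R.
  have := @card_supersets (block (i * h) h); rewrite card_block // => <-;
    last by lia.
  by congr _%:R; apply: eq_card => S; rewrite !inE andbC.
have cardAA i j : i != j ->
    #|ksets :&: A i :&: A j|%:R <= 'C(N - (h + h), k - (h + h))%:R :> R.
  move=> ij; rewrite ler_nat.
  have cU : #|block (i * h) h :|: block (j * h) h| = (h + h)%N.
    rewrite cardsU !card_block // (_ : _ :&: _ = finset.set0) ?cards0 ?subn0 //.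
    apply/setP => x; rewrite !inE;
      apply/negbTE/negP => /andP[/andP[i1 i2] /andP[j1 j2]].
    move/eqP: ij; apply; apply: val_inj => /=; nia.
  have := @card_supersets (block (i * h) h :|: block (j * h) h).
  rewrite cU => <-; last by lia.
  apply: subset_leq_card; apply/fintype.subsetP => S;
    rewrite !inE finset.subUset.
  by move=> /andP[/andP[-> ->] ->].
have drop2 : 'C(N - (h + h), k - (h + h))%:R * #|ksets|%:R <=
  'C(N - h, k - h)%:R ^+ 2 :> R.
  by rewrite card_ksets -natrM -natrX ler_nat expnS expn1 binomial_drop_sub
    //; lia.
have := second_moment cardA cardAA drop2; rewrite card_ksets => main.
have sub : #|[set S : {set 'I_N} | ~~ has_run h S && (#|S| == k)]|%:R <=
    #|ksets :\: \bigcup_i A i|%:R :> R.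
  rewrite ler_nat; apply: subset_leq_card; apply/fintype.subsetP => S;
    rewrite !inE.
  move=> /andP[nr ->]; rewrite andbT; apply: contra nr => /finset.bigcupP[i _].
  rewrite inE => iS; apply/existsP.
  have lti : (i * h < N.+1)%N by have := fit i; lia.
  by exists (Ordinal lti); rewrite /= fit iS.
have N0' : 0 < N%:R :> R by rewrite ltr0n.
have t0 : 0 < 'C(N, k)%:R :> R by rewrite ltr0n bin_gt0.
rewrite -(ler_pM2r t0) -expr2; apply: le_trans main.
rewrite -!mulrA; apply: ler_pM; rewrite ?mulr_ge0 ?exprn_ge0 ?divr_ge0 //.
rewrite ler_wpM2l // expr_div_n mulrAC ler_pdivrMr ?exprn_gt0 // -!natrX
  -!natrM ler_nat.
have [] : _ /\ _ := @binomial_drop h _; first by lia.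
by [].
Qed.

End runs.

(** * Concentration of the binomial law *)

Section binomial_tail.
Context {R : realType}.

Lemma expR_le_quadratic (l : R) : `|l| <= 1 / 2 -> expR l <= 1 + l + 2 * l ^+ 2.
Proof.
rewrite ler_norml => /andP[l1 l2].
have h : 1 - l <= expR (- l) by have := expR_ge1Dx (- l); lra.
have e0 : 0 < expR l by exact: expR_gt0.
have : expR l * (1 - l) <= 1.
  by apply: le_trans (ler_wpM2l (ltW e0) h) _; rewrite -expRD subrr expR0.
have q : 1 <= (1 - l) * (1 + l + 2 * l ^+ 2).
  have : 0 <= l ^+ 2 * (1 - 2 * l) by rewrite mulr_ge0 ?sqr_ge0 //; lra.
  lra.
have l0 : 0 < 1 - l by lra.
move=> /le_trans/(_ q); rewrite mulrC ler_pM2l //.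
Qed.

(** The left-hand side is (1 - p + p e^l)^N, by the binomial theorem. *)
Lemma binomial_mgf (p l : R) N : 0 <= p <= 1 -> `|l| <= 1 / 2 ->
  \sum_(k < N.+1) 'C(N, k)%:R * (p ^+ k * (1 - p) ^+ (N - k)) * expR (l * k%:R)
  <= expR (N%:R * (p * l + 2 * l ^+ 2)).
Proof.
move=> /andP[p0 p1] l12; rewrite mulrC expRM_natr.
apply: (@le_trans _ _ (((1 - p) + p * expR l) ^+ N)).
  rewrite exprDn le_eqVlt; apply/orP; left; apply/eqP; apply: eq_bigr => k _.
  by rewrite expRM_natr exprMn -mulr_natl; ring.
rewrite lerXn2r ?nnegrE ?expR_ge0 //.
  by rewrite addr_ge0 ?mulr_ge0 ?expR_ge0 ?subr_ge0.
apply: le_trans (expR_ge1Dx _).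
have : p * expR l <= p * (1 + l + 2 * l ^+ 2) by rewrite ler_wpM2l //
  expR_le_quadratic.
have : p * (2 * l ^+ 2) <= 1 * (2 * l ^+ 2) by rewrite ler_wpM2r // mulr_ge0
  // sqr_ge0.
lra.
Qed.

(** Chernoff's method with the exponent [d / 4] on either side. *)
Lemma binomial_tail (p d : R) N : 0 <= p <= 1 -> 0 < d <= 1 ->
  \sum_(k < N.+1 | ~~ (`|k%:R - p * N%:R| <= d * N%:R))
     'C(N, k)%:R * (p ^+ k * (1 - p) ^+ (N - k))
  <= 2 * expR (- (d ^+ 2 / 8 * N%:R)).
Proof.
move=> p01 /andP[d0 d1]; have /andP[p0 p1] := p01.
pose l := d / 4.
have l0 : 0 < l by rewrite /l; lra.
have lle : `|l| <= 1 / 2 by rewrite gtr0_norm // /l; lra.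
have lle' : `|- l| <= 1 / 2 by rewrite normrN.
pose w k : R := 'C(N, k)%:R * (p ^+ k * (1 - p) ^+ (N - k)).
have w0 k : 0 <= w k by rewrite /w !mulr_ge0 ?exprn_ge0 // subr_ge0.
have tail (l' t : R) : `|l'| <= 1 / 2 ->
  N%:R * (p * l' + 2 * l' ^+ 2) - t = - (d ^+ 2 / 8 * N%:R) ->
    \sum_(k < N.+1) w k * expR (l' * k%:R - t) <= expR (- (d ^+ 2 / 8 * N%:R)).
  move=> l'le <-; rewrite [leRHS]expRD.
  under eq_bigr => k _ do rewrite expRD mulrA.
  by rewrite -mulr_suml ler_wpM2r ?expR_ge0 // binomial_mgf.
have T1 := tail l (l * ((p + d) * N%:R)) lle.
have T2 := tail (- l) (- l * ((p - d) * N%:R)) lle'.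
rewrite [2 * _]mulr_natl mulr2n; apply: le_trans (lerD (T1 _) (T2 _));
  last 2 first.
- by rewrite /l; field.
- by rewrite /l; field.
rewrite -big_split big_mkcond /=; apply: ler_sum => k _;
  rewrite -mulrDr -/(w k).
case: ifPn; last by rewrite mulr_ge0 // addr_ge0 ?expR_ge0.
rewrite -ltNge ltr_normr => /orP far; rewrite ler_peMr //.
case: far => far.
  apply: (@le_trans _ _ (expR (l * k%:R - l * ((p + d) * N%:R)))); last first.
    by rewrite lerDl expR_ge0.
  have : 0 <= l * (k%:R - (p + d) * N%:R) by rewrite mulr_ge0 ?(ltW l0) //; lra.
  by rewrite -expR0 ler_expR; lra.
apply: (@le_trans _ _ (expR (- l * k%:R - (- l * ((p - d) * N%:R)))));
  last first.
  by rewrite lerDr expR_ge0.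
have : 0 <= l * ((p - d) * N%:R - k%:R) by rewrite mulr_ge0 ?(ltW l0) //; lra.
by rewrite -expR0 ler_expR; lra.
Qed.

End binomial_tail.

(** * The law of the conditioned Galton-Watson tree *)

Lemma tree_ind_nth (Q : tree -> Prop) :
  (forall s, (forall i, (i < size s)%N -> Q (nth leaf s i)) -> Q (Node s)) ->
  forall t, Q t.
Proof.
move=> H t; have [n] := ubnP (tree_size t); elim: n t => // n IHn [s] /=;
  rewrite ltnS => lesn.
apply: H => i lti; apply: IHn; apply: leq_ltn_trans lesn.
rewrite -(cat_take_drop i s) map_cat sumn_cat (drop_nth leaf lti) /= nth_cat.
by rewrite size_takel ?ltnn ?subnn //=; lia.
Qed.

(** The condition that defines the event [GW_eq], for fixed offspring
    numbers [x]. *)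
Definition prescribes (x : seq nat -> nat) (t : tree) : Prop :=
  forall u s, fringe_subtree t u = Some s -> x u = size (children s).

(** Offspring numbers determine the tree, so the events that the
    Galton-Watson tree equals a given tree are disjoint. *)
Lemma prescribes_inj x t t' : prescribes x t -> prescribes x t' -> t = t'.
Proof.
elim/tree_ind_nth: t x t' => s IH x [s'] xs xs'.
have szs : size s = size s' by rewrite -[LHS](xs [::] _ erefl) (xs' [::]
  _ erefl).
congr Node; apply: (@eq_from_nth _ leaf) => // i lti.
apply: (IH i lti (fun u => x (i :: u))) => u r E.
  by apply: (xs (i :: u)); rewrite fringe_subtree_Node.
by apply: (xs' (i :: u)); rewrite fringe_subtree_Node // -szs.
Qed.

(** The Ulam-Harris words of the nodes in preorder, so that reading the
    outdegrees along this list gives the word of the tree. *)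
Fixpoint addresses (t : tree) : seq (seq nat) :=
  let: Node s := t in
  [::] :: [seq i :: u | i <- iota 0 (size s), u <- nth [::]
    (map addresses s) i].

Definition outdegree (t : tree) (u : seq nat) : nat :=
  if fringe_subtree t u is Some s then size (children s) else 0.

Lemma addresses_Node s : addresses (Node s) =
  [::] :: [seq i :: u | i <- iota 0 (size s), u <- addresses (nth leaf s i)].
Proof.
rewrite /=; congr (_ :: flatten _); apply/eq_in_map => i;
  rewrite mem_iota => lti.
by rewrite (nth_map leaf).
Qed.

Lemma mem_addresses t u : (u \in addresses t) = (fringe_subtree t u != None).
Proof.
elim: u t => [|i u IHu] [s]; first by rewrite inE.
rewrite addresses_Node inE /= onthE.
have [lti|lei] := ltnP i (size s).
  rewrite (nth_map leaf) // -IHu; apply/idP/idP.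
    move=> /(@allpairsPdep nat (fun=> seq nat) (seq nat) (fun i u =>
      i :: u)) [j [v]].
    by move=> [_ vj [-> ->]].
  move=> uj; apply/(@allpairsPdep nat (fun=> seq nat) (seq nat) (fun i u =>
    i :: u)).
  by exists i, u; split => //; rewrite mem_iota.
rewrite nth_default ?size_map //; apply/negbTE/negP.
move=> /(@allpairsPdep nat (fun=> seq nat) (seq nat) (fun i u =>
  i :: u)) [j [v]].
by move=> [+ _ [ij _]]; rewrite mem_iota -ij; lia.
Qed.

Lemma uniq_addresses t : uniq (addresses t).
Proof.
elim/tree_ind_nth: t => s IH; rewrite addresses_Node cons_uniq; apply/andP;
  split.
  by apply/negP => /(@allpairsPdep nat (fun=> seq nat) (seq nat) (fun i u =>
    i :: u)) [j [v []]].
apply: (@allpairs_uniq_dep nat (fun=> seq nat) (seq nat) (fun i u => i :: u)).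
- exact: iota_uniq.
- by move=> i; rewrite mem_iota => lti; exact: IH.
by move=> [i u] [j v] _ _ /= [-> ->].
Qed.

Lemma map_outdegree t : [seq outdegree t u | u <- addresses t] = word t.
Proof.
elim/tree_ind_nth: t => s IH; rewrite addresses_Node map_cons /=;
  congr (_ :: _).
rewrite -[in RHS](mkseq_nth leaf s) /mkseq -map_comp map_flatten -map_comp.
congr flatten; apply/eq_in_map => i; rewrite mem_iota /= => lti.
rewrite -IH // -map_comp; apply: eq_map => u /=.
by rewrite /outdegree fringe_subtree_Node.
Qed.

Section conditioned.
Local Open Scope classical_set_scope.
Context {R : realType} {d : measure_display} {S : measurableType d}
  (P : probability S R) (xi : {RV P >-> nat})
  {d' : measure_display} {Omega : measurableType d'} (Q : probability Omega R)
  (X : seq nat -> {RV Q >-> nat}).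
Hypothesis X_law : forall u B, distribution Q (X u) B = distribution P xi B.
Hypothesis X_indep : mutually_independent X.

Definition offspring_prob (k : nat) : R := fine (P (xi @^-1` [set k])).
Local Notation p := offspring_prob.

Lemma measurable_preim_nat d0 (T : measurableType d0) (Y : {mfun T >-> nat})
  (B : set nat) :
  measurable (Y @^-1` B).
Proof. by rewrite -[X in measurable X]setTI; exact: measurable_funP. Qed.

Lemma offspring_probE k : P (xi @^-1` [set k]) = (p k)%:E.
Proof. by rewrite fineK // fin_num_measure //; exact: measurable_preim_nat. Qed.

Lemma GW_eq_bigcap t : GW_eq X t =
  \bigcap_(u in [set` [fset u in addresses t]%fset])
    (X u @^-1` [set outdegree t u]).
Proof.
apply/seteqP; split => w /=.
  move=> Xt u /=; rewrite !inE mem_addresses /outdegree.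
  by case E: (fringe_subtree t u) => [s|] // _; exact: Xt.
move=> Xt u s us; have := Xt u.
by rewrite /= !inE mem_addresses us /outdegree us; exact.
Qed.

(** The event constrains the offspring numbers at the nodes of [t] only, which
    are independent. *)
Lemma prob_GW_eq t : Q (GW_eq X t) = (weight p [:: t])%:E.
Proof.
rewrite GW_eq_bigcap X_indep //; under eq_bigr => u _ do
  rewrite [Q _](_ : _ = distribution Q (X u) [set outdegree t u]) // X_law
   [distribution _ _ _]offspring_probE.
rewrite prodEFin; congr EFin.
rewrite /weight forest_word1 -map_outdegree big_map; apply: perm_big.
apply: uniq_perm => [||u]; [exact: fset_uniq|exact: uniq_addresses|].
by rewrite !inE.
Qed.

Lemma measurable_GW_eq t : measurable (GW_eq X t).
Proof.
rewrite GW_eq_bigcap; apply: fin_bigcap_measurable => // u _;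
  exact: measurable_preim_nat.
Qed.

Lemma prob_GW_size_in n (A : set tree) :
  Q (GW_size_in X n A) =
  (\sum_(s <- forests n 1 | `[< A (head leaf s) >]) weight p s)%:E.
Proof.
pose r := [seq s <- forests n 1 | `[< A (head leaf s) >]].
have rP s : s \in r -> exists2 t, s = [:: t] & tree_size t = n /\ A t.
  rewrite mem_filter mem_forests; case: s => [|t [|t' s]] //=;
    rewrite ?andbF //.
  by rewrite size_forest_word /= addn0 => /andP[/asboolP At /eqP]; exists t.
have -> : GW_size_in X n A = \bigcup_(s in [set` r]) GW_eq X (head leaf s).
  apply/seteqP; split => w /=.
    move=> [t [Xt tn At]]; exists [:: t] => //=.
    rewrite mem_filter mem_forests /= size_forest_word /= addn0 tn !eqxx.
    by rewrite !andbT; apply/asboolP.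
  by move=> [s /rP[t -> [tn At]] Xt]; exists t.
rewrite measure_fin_bigcup //.
- rewrite -fsbig_seq ?filter_uniq ?uniq_forests // big_filter -sumEFin.
  rewrite big_seq_cond [RHS]big_seq_cond; apply: eq_bigr => s sr.
  have /rP[t st _] : s \in r by rewrite mem_filter andbC.
  by rewrite st /= prob_GW_eq.
- exact: finite_seq.
- move=> s s' /rP[t -> _] /rP[t' -> _] /= [w [Xt Xt']]; congr [:: _].
  exact: (@prescribes_inj (fun u => X u w)).
by move=> s _; exact: measurable_GW_eq.
Qed.

Lemma cond_GWE n A : cond_GW X n A =
  (\sum_(s <- forests n 1 | `[< A (head leaf s) >]) weight p s) / forest_mass
    p n 1.
Proof.
rewrite /cond_GW !prob_GW_size_in /=; congr (_ / _).
by apply: eq_bigl => s; apply/asboolP.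
Qed.

Lemma offspring_prob_ge0 k : 0 <= p k.
Proof. exact: fine_ge0. Qed.

Let trivI : trivIset setT (fun k => xi @^-1` [set k]).
Proof. by move=> i j _ _ /= [w /= [-> ->]]. Qed.

Let bigT : \bigcup_k (xi @^-1` [set k]) = setT.
Proof. by apply/seteqP; split => // w _; exists (xi w). Qed.

Lemma offspring_prob_sum : \sum_(k < K) p k @[K --> \oo] --> (1 : R).
Proof.
have H : (\sum_(0 <= i < n) P (xi @^-1` [set i]))%E @[n --> \oo] --> 1%E.
  rewrite -(@probability_setT _ _ _ P) -bigT;
    apply: measure_semi_sigma_additive => //.
    by move=> k; exact: measurable_preim_nat.
  by rewrite bigT.
have -> : (fun K : nat => \sum_(k < K) p k) =
    fine \o (fun n => (\sum_(0 <= i < n) P (xi @^-1` [set i]))%E).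
  apply/funext => K /=.
  rewrite (eq_bigr (fun i => (p i)%:E)); last by move=> i _;
    exact: offspring_probE.
  by rewrite sumEFin /= big_mkord.
exact: fine_cvg H.
Qed.

Lemma measurable_nat_fun (f : nat -> \bar R) :
  measurable_fun setT (fun w => f (xi w)).
Proof.
move=> _ B _; rewrite setTI -[X in measurable X]/(xi @^-1` (f @^-1` B)).
exact: measurable_preim_nat.
Qed.

Lemma offspring_prob_mean : ('E_P[fun w => (xi w)%:R] = 1)%E ->
  \sum_(k < K) k%:R * p k @[K --> \oo] --> (1 : R).
Proof.
rewrite unlock -bigT ge0_integral_bigcup //; last 2 first.
- by move=> k; exact: measurable_preim_nat.
- by rewrite bigT; exact: (measurable_nat_fun (fun k => (k%:R : R)%:E)).
have E k : (\int[P]_(w in xi @^-1` [set k]) ((xi w)%:R)%:E = (k%:R * p k)%:E)%E.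
  rewrite (eq_integral (cst (k%:R)%:E)); last by move=> w; rewrite inE /= => ->.
  rewrite integral_cst; last exact: measurable_preim_nat.
  by rewrite EFinM; congr (_ * _)%E; exact: offspring_probE.
under eq_eseriesr => k _ do rewrite E.
move=> lim1.
have cv : cvg ((\sum_(0 <= k < n) (k%:R * p k)%:E)%E @[n --> \oo]).
  by apply: is_cvg_nneseries => k _ _;
    rewrite lee_fin mulr_ge0 ?offspring_prob_ge0.
have -> : (fun K : nat => \sum_(k < K) k%:R * p k) =
    fine \o (fun n => (\sum_(0 <= i < n) (i%:R * p i)%:E)%E).
  by apply/funext => K /=; rewrite sumEFin /= big_mkord.
by apply: fine_cvg; rewrite -lim1; exact: cv.
Qed.

(** If [xi] were almost surely 1, its variance would vanish. *)
Lemma offspring_prob1_lt1 : ('E_P[fun w => (xi w)%:R] = 1)%E ->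
  (0 < 'V_P[fun w => (xi w)%:R])%E -> p 1 < 1.
Proof.
move=> mean1; apply: contraTT; rewrite -leNgt => p1ge.
have p1E : P (xi @^-1` [set 1%N]) = 1%E.
  apply/eqP; rewrite eq_le probability_le1 ?offspring_probE ?lee_fin //.
  exact: measurable_preim_nat.
have PC : P (~` (xi @^-1` [set 1%N])) = 0%E.
  by rewrite probability_setC ?p1E ?subee //; exact: measurable_preim_nat.
rewrite /variance covariance.unlock mean1 /= unlock (ae_eq_integral (cst 0%E))
  //.
- by rewrite integral0 ltxx.
- exact: (measurable_nat_fun (fun k => (((k%:R - 1) * (k%:R - 1)) : R)%:E)).
exists (~` (xi @^-1` [set 1%N])); split => //.
  by apply: measurableC; exact: measurable_preim_nat.
move=> w /= H x1; apply: H => _ /=.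
by rewrite /GRing.mul /= x1 subrr mul0r.
Qed.

End conditioned.

(** * Height of the longest chain and runs of unary positions *)

Section runs_and_height.
Variable N : nat.

Lemma has_runE t h : [:: t] \in forests N.+1 1 ->
  has_run h (unary_positions N [:: t]) = infix (nseq h 1%N) (word t).
Proof.
rewrite mem_forests forest_word1 /= => /eqP szw.
apply/existsP/idP => [[a /andP[le_ahN /fintype.subsetP sub]]|].
  have -> : nseq h 1%N = take h (drop a (word t)).
    apply: (@eq_from_nth _ 0%N) => [|i].
      by rewrite size_nseq size_takel // size_drop szw; lia.
    rewrite size_nseq => ltih; rewrite nth_nseq ltih nth_take // nth_drop.
    have lt : (a + i < N)%N by lia.
    have := sub (Ordinal lt); rewrite !inE /= forest_word1 => H.
    by apply/esym/eqP/H; lia.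
  exact: infix_trans (infix_take _ _) (infix_drop _ _).
case: h => [_|h]; first by exists ord0; apply/fintype.subsetP => i;
  rewrite !inE; lia.
move=> /infixP run.
have {run}[u [v uv]] : exists u v : seq nat, word t = u ++ nseq h.+1 1%N ++ v
  by [].
have lastw := last_word t 0%N; rewrite uv catA last_cat in lastw.
have szv : (0 < size v)%N.
  case: v uv lastw => // _; by rewrite last_cat /=; elim: h.
have := szw; rewrite uv !size_cat size_nseq => szs.
have lta : (size u < N.+1)%N by lia.
exists (Ordinal lta); rewrite /=; apply/andP; split; first by lia.
apply/fintype.subsetP => i; rewrite !inE forest_word1 uv => /andP[lei lti].
rewrite nth_cat ltnNge lei nth_cat size_nseq nth_nseq.
by have -> : (i - size u < h.+1)%N by lia.
Qed.

Lemma has_run_Hbar1 t h : [:: t] \in forests N.+1 1 ->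
  has_run h (unary_positions N [:: t]) = (h <= Hbar1 t)%N.
Proof.
move=> tF; rewrite has_runE //; apply/idP/idP.
  by move=> /contains_chainP /Hbar1_max.
move=> leh; have /contains_chainP := Hbar1_contains t.
rewrite -(subnKC leh) nseqD; exact: catr_infix.
Qed.

End runs_and_height.

Section powers.
Context {R : realType}.

Lemma expRN_pow_le (b x : R) h : 0 <= b -> x - 1 <= h%:R ->
  expR (- b) ^+ h <= expR b * expR (- (b * x)).
Proof.
move=> b0 xh; rewrite -expRM_natr -expRD ler_expR.
have : b * (x - 1) <= b * h%:R by rewrite ler_wpM2l.
lra.
Qed.

Lemma expRN_pow_ge (b x : R) h : 0 <= b -> h%:R <= x + 1 ->
  expR (- b) * expR (- (b * x)) <= expR (- b) ^+ h.
Proof.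
move=> b0 xh; rewrite -expRM_natr -expRD ler_expR.
have : b * h%:R <= b * (x + 1) by rewrite ler_wpM2l.
lra.
Qed.

Lemma mul_expRN_le (c y : R) : 0 < c ->
  y * expR (- (c * y)) <= (2 / c) * expR (- (c / 2 * y)).
Proof.
move=> c0; have -> : - (c * y) = - (c / 2 * y) + - (c / 2 * y) by field.
rewrite expRD mulrA ler_wpM2r ?expR_ge0 //.
rewrite -ler_pdivlMr ?expR_gt0 // -expRN opprK.
have := expR_ge1Dx (c / 2 * y) => h.
have : (2 / c) * (c / 2 * y) <= (2 / c) * expR (c / 2 * y).
  by rewrite ler_wpM2l ?divr_ge0 ?ltW //; lra.
by rewrite mulrA (_ : 2 / c * (c / 2) = 1) ?mul1r //; field; rewrite gt_eqF.
Qed.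

End powers.

(** * Runs of critical length *)

Section typical_runs.
Context {R : realType}.
(** A run of length (1 + eps) log_{1/p1} n would occur with probability about
    n^(-eps) at density p1.  Enlarging the density to the power
    (1 + eps / 2) / (1 + eps) of p1 leaves n^(-eps / 2). *)
Lemma long_runs_rare (p1 eps : R) : 0 < p1 < 1 -> 0 < eps ->
  exists d K : R, [/\ 0 < d, 0 <= K &
  forall N k h : nat, (k <= N)%N -> k%:R <= (p1 + d) * N%:R ->
    (1 + eps) * (ln N.+1%:R / - ln p1) - 1 <= h%:R ->
    #|[set S : {set 'I_N} | has_run h S && (#|S| == k)]|%:R <=
      K * expR (- (eps / 2 * ln N.+1%:R)) * 'C(N, k)%:R].
Proof.
move=> /andP[p1_gt0 p1_lt1] eps_gt0; set a := - ln p1.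
have a_gt0 : 0 < a by rewrite oppr_gt0 ln_lt0 // p1_gt0.
have p1E : p1 = expR (- a) by rewrite opprK lnK.
pose b := a * ((1 + eps / 2) / (1 + eps)).
have b0 : 0 < b by rewrite mulr_gt0 // divr_gt0 //; lra.
have ba : b < a by rewrite gtr_pMr // ltr_pdivrMr //; lra.
exists (expR (- b) - p1), (expR b); split => [||N k h leN lek leh].
- by rewrite subr_gt0 [ltLHS]p1E ltr_expR; lra.
- exact: expR_ge0.
have [N0|N0] := posnP N.
  have k0 : k = 0%N by lia.
  apply: (@le_trans _ _ 'C(N, k)%:R); first by rewrite ler_nat card_ksets_sub.
  by rewrite [in ln _]N0 ln1 mulr0 oppr0 expR0 mulr1 ler_peMl // -expR0
    ler_expR ltW.
apply: (le_trans (card_run_le leN h N0)); rewrite ler_wpM2r //.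
have NR : 0 < N%:R :> R by rewrite ltr0n.
have kr : k%:R / N%:R <= expR (- b) by rewrite ler_pdivrMr //; lra.
have y0 : 0 < N.+1%:R :> R by rewrite ltr0n.
have {1}-> : N.+1%:R = expR (ln N.+1%:R) :> R by rewrite lnK.
set y := ln _ in leh *.
have pw : (k%:R / N%:R) ^+ h <= expR b * expR (- (b * ((1 + eps) * (y / a)))).
  apply: le_trans (expRN_pow_le (ltW b0) leh).
  by rewrite lerXn2r // nnegrE ?expR_ge0 // divr_ge0.
apply: (le_trans (ler_wpM2l (expR_ge0 y) pw)).
have -> : b * ((1 + eps) * (y / a)) = (1 + eps / 2) * y.
  by rewrite /b; field; rewrite !gt_eqF //; lra.
rewrite mulrCA ler_wpM2l ?expR_ge0 // -expRD ler_expR; lra.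
Qed.

(** The quadratic lower bound on the exponential function gives an explicit
    threshold. *)
Lemma log_le_linear (c d : R) : 0 < c -> 0 < d -> exists y0 : R, 1 <= y0 /\
  forall N : nat, y0 <= ln N.+1%:R -> c * ln N.+1%:R <= d * N%:R.
Proof.
move=> c0 d0; exists (Num.max 1 (4 * c / d)); split;
  first by rewrite le_max lexx.
move=> N; set y := ln _; rewrite ge_max => /andP[y1 yc].
have -> : N%:R = expR y - 1 :> R by rewrite lnK ?posrE ?ltr0n // -natr1 addrK.
have y24 : y ^+ 2 / 4 <= expR y - 1.
  have -> : y = y / 2 + y / 2 by field.
  have h := expR_ge1Dx (y / 2).
  have : (1 + y / 2) * (1 + y / 2) <= expR (y / 2) * expR (y / 2).
    by apply: ler_pM => //; lra.
  rewrite expRD; lra.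
apply: le_trans (ler_wpM2l (ltW d0) y24).
move: yc; rewrite ler_pdivrMr // => yc.
have : 4 * c * y <= y * d * y by rewrite ler_wpM2r //; lra.
lra.
Qed.

(** There are about n / h disjoint blocks, each full with probability close to
    n^(-(1 - eps)) at density p1, or n^(-(1 - eps / 2)) once the density is
    lowered to the power (1 - eps / 2) / (1 - eps) of p1.  The reciprocal of the
    mean number of full blocks is of order h n^(-eps / 2), and the factor h is
    absorbed by half of the exponent. *)
Lemma short_runs_rare (p1 eps : R) : 0 < p1 < 1 -> 0 < eps <= 1 / 2 ->
  exists d K y0 : R, [/\ 0 < d, 0 <= K &
  forall N k h : nat, (k <= N)%N -> (p1 - d) * N%:R <= k%:R ->
    (0 < h)%N -> h%:R <= (1 - eps) * (ln N.+1%:R / - ln p1) + 1 ->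
      y0 <= ln N.+1%:R ->
    #|[set S : {set 'I_N} | ~~ has_run h S && (#|S| == k)]|%:R <=
      K * expR (- (eps / 4 * ln N.+1%:R)) * 'C(N, k)%:R].
Proof.
move=> /andP[p1_gt0 p1_lt1] /andP[eps_gt0 eps_le]; set a := - ln p1.
have a_gt0 : 0 < a by rewrite oppr_gt0 ln_lt0 // p1_gt0.
have p1E : p1 = expR (- a) by rewrite opprK lnK.
pose b := a * ((1 - eps / 2) / (1 - eps)).
have b0 : 0 < b by rewrite mulr_gt0 // divr_gt0 //; lra.
have ab : a < b by rewrite ltr_pMr // ltr_pdivlMr //; lra.
pose s := expR (- b).
have s0 : 0 < s by exact: expR_gt0.
have sp : s < p1 by rewrite [ltRHS]p1E ltr_expR; lra.
pose d := (p1 - s) / 2.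
have d0 : 0 < d by rewrite /d; lra.
pose c := a^-1 + 1.
have ai0 : 0 < a^-1 by rewrite invr_gt0.
have c0 : 0 < c by rewrite /c; lra.
have d20 : 0 < d / 2 by lra.
have [y0 [y01 big]] := log_le_linear c0 d20.
exists d, (4 / s * c * (4 / eps)), y0; split => //.
  by rewrite ltW // !mulr_gt0 ?invr_gt0.
move=> N k h leN gek h0 leh gey.
have {big}cyN := big N gey.
move: leh gey cyN; set y := ln _ => leh gey cyN.
have y1 : 1 <= y by lra.
have ya0 : 0 <= eps * (y / a) by rewrite mulr_ge0 ?divr_ge0 ?(ltW a_gt0) ?(ltW
  eps_gt0) //; lra.
have hc : h%:R <= c * y by rewrite /c; lra.
have hN : h%:R <= d / 2 * N%:R by lra.
have N0 : 0 <= N%:R :> R by [].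
have h1 : 1 <= h%:R :> R by rewrite ler1n.
have NR : 0 < N%:R :> R.
  rewrite lt_def N0 andbT; apply/eqP => N00; move: hN; rewrite N00 mulr0; lra.
have N1 : 1 <= N%:R :> R by rewrite ler1n -(ltr0n R).
have sN : 0 <= s * N%:R by rewrite mulr_ge0 // ltW.
have kN : (s + d) * N%:R <= k%:R by apply: le_trans gek;
  rewrite ler_wpM2r // /d; lra.
have hk : (2 * h <= k)%N by rewrite -(ler_nat R) natrM; lra.
have base : s <= (k - h)%:R / N%:R.
  have lehk : (h <= k)%N by apply: leq_trans hk; rewrite leq_pmull.
  rewrite ler_pdivlMr // natrB //.
  have : d / 2 * N%:R <= d * N%:R by rewrite ler_wpM2r //; lra.
  lra.
pose r := (N %/ h)%N.
have rhN : (r * h <= N)%N by rewrite leq_trunc_div.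
have dle : d <= 1 / 2 by rewrite /d; lra.
have dN : d * N%:R <= 1 / 2 * N%:R by rewrite ler_wpM2r.
have rbig : N.+1%:R / 4 <= r%:R * h%:R :> R.
  have : (N < r * h + h)%N by rewrite -mulSnr ltn_ceil.
  rewrite -(ltr_nat R) natrD natrM -natr1; lra.
have main := @card_norun_le R N k leN h r rhN hk.
have pw : s * expR (- ((1 - eps / 2) * y)) <= ((k - h)%:R / N%:R) ^+ h.
  apply: (@le_trans _ _ (s ^+ h));
    last by rewrite lerXn2r // nnegrE ?divr_ge0 // ltW.
  have := expRN_pow_ge (ltW b0) leh.
  have -> // : b * ((1 - eps) * (y / a)) = (1 - eps / 2) * y.
  by rewrite /b; field; rewrite !gt_eqF //; lra.
set nu : R := #|_|%:R in main *; set C : R := 'C(N, k)%:R in main *.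
have nu0 : 0 <= nu by exact: ler0n.
have hR : 0 < h%:R :> R by lra.
have r0 : 0 <= r%:R :> R by [].
have key : nu * (expR (eps / 2 * y) * s) <= 4 * h%:R * C.
  apply: le_trans (ler_wpM2l (_ : 0 <= 4 * h%:R) main);
    last by rewrite mulr_ge0.
  rewrite [leRHS]mulrCA ler_wpM2l // [leRHS]mulrA.
  have -> : expR (eps / 2 * y) * s = N.+1%:R * (s * expR (- ((1 - eps / 2) *
    y))).
    have -> : N.+1%:R = expR y :> R by rewrite lnK // posrE ltr0n.
    by rewrite [RHS]mulrCA -[expR y * _]expRD [RHS]mulrC; congr (expR _ * s);
      lra.
  apply: ler_pM => //; first by rewrite mulr_ge0 ?expR_ge0 ?(ltW s0).
  by lra.
have E0 : 0 < expR (eps / 2 * y) * s by rewrite mulr_gt0 ?expR_gt0.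
rewrite -ler_pdivlMr // in key; apply: (le_trans key).
have C0 : 0 <= C by exact: ler0n.
have -> : 4 * h%:R * C / (expR (eps / 2 * y) * s) = 4 / s * (h%:R * expR (-
  (eps / 2 * y))) * C.
  by rewrite expRN; field; rewrite !gt_eqF // expR_gt0.
have hexp : h%:R * expR (- (eps / 2 * y)) <=
  c * (4 / eps * expR (- (eps / 4 * y))).
  apply: (@le_trans _ _ (c * (y * expR (- (eps / 2 * y))))).
    by rewrite mulrA ler_wpM2r ?expR_ge0.
  have e2 : 0 < eps / 2 by lra.
  have := mul_expRN_le y e2.
  have -> : 2 / (eps / 2) = 4 / eps by field; rewrite gt_eqF.
  have -> : eps / 2 / 2 = eps / 4 by field.
  by apply: ler_wpM2l; exact: ltW.
have s4 : 0 <= 4 / s by rewrite divr_ge0 // ltW.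
rewrite ler_wpM2r //; apply: (le_trans (ler_wpM2l s4 hexp)).
by rewrite !mulrA.
Qed.
End typical_runs.

(** * The longest chain of a random tree *)

Section critical_offspring.
Context {R : realType} (p : nat -> R).
Hypothesis p_ge0 : forall d, 0 <= p d.
Hypothesis p_sum : (\sum_(k < K) p k @[K --> \oo] --> (1 : R))%classic.
Hypothesis p_mean : (\sum_(k < K) k%:R * p k @[K --> \oo] --> (1 : R))%classic.
Hypothesis p1_lt1 : p 1 < 1.

Lemma partial_mass_le1 K : \sum_(k < K) p k <= 1.
Proof.
rewrite -(cvg_lim (@Rhausdorff R) p_sum).
apply: (@nondecreasing_cvgn_le _ (fun K => \sum_(k < K) p k)).
  by apply/nondecreasing_seqP => n; rewrite big_ord_recr /= lerDl.
by apply/cvg_ex; exists 1.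
Qed.

(** Otherwise the mean would be [p 1], which is smaller than 1. *)
Lemma exists_branching : exists2 k, (1 < k)%N & 0 < p k.
Proof.
apply: contrapT => none.
have pk0 k : (1 < k)%N -> p k = 0.
  move=> k1; apply/eqP; rewrite eq_le p_ge0 andbT leNgt; apply/negP => pk.
  by apply: none; exists k.
suff : 1 <= p 1 by rewrite leNgt p1_lt1.
apply: (ler_cvg_to p_mean (cvg_cst (p 1))); near=> K.
have K2 : (1 < K)%N by near: K; exact: nbhs_infty_gt.
rewrite (bigD1 (Ordinal K2)) //= mul1r big1 ?addr0 // => -[[|[|k]] ltk] //= _.
- by rewrite mul0r.
- by rewrite pk0 ?mulr0.
Unshelve. all: by end_near. Qed.

(** Otherwise sum_k (k - 1) p_k, which is 0 by criticality, would have
    non-negative terms and a positive one. *)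
Lemma p0_gt0 : 0 < p 0.
Proof.
rewrite lt_def p_ge0 andbT; apply/eqP => p00.
have [k k1 pk] := exists_branching.
have cv : (\sum_(i < K) i%:R * p i - \sum_(i < K) p i @[K --> \oo]
  --> (1 - 1 : R))%classic.
  exact: cvgB.
have c0 : 0 < (k%:R - 1) * p k by rewrite mulr_gt0 // subr_gt0 ltr1n.
suff : (k%:R - 1) * p k <= 1 - 1 by lra.
apply: (ler_cvg_to (cvg_cst _) cv); near=> K.
have ltK : (k < K)%N by near: K; exact: nbhs_infty_gt.
rewrite -sumrB (bigD1 (Ordinal ltK)) //= [X in _ <=
  X + _](_ : _ = (k%:R - 1) * p k).
  rewrite lerDl.
  apply: sumr_ge0 => -[[|i] lti] _ /=; first by rewrite p00 mul0r subrr.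
  by rewrite -[X in _ - X]mul1r -mulrBl mulr_ge0 // subr_ge0 ler1n.
by rewrite mulrBl mul1r.
Unshelve. all: by end_near. Qed.

(** A polynomial rate of convergence.  Trees with a typical number of unary
    nodes are handled by the two estimates on runs, and the others by the
    Chernoff bound [exp (- d^2 N / 8)] divided by Z_n, which is at least of
    order [exp (- d^2 N / 16)]. *)
Lemma chain_height_tail (eps : R) : 0 < p 1 -> 0 < eps <= 1 / 2 ->
  exists K c y0 : R, 0 < c /\ forall N, y0 <= ln N.+1%:R ->
    (\sum_(s <- forests N.+1 1 |
        eps < `| (Hbar1 (head leaf s))%:R / (ln N.+1%:R / - ln (p 1)) - 1 |)
          weight p s)
      / forest_mass p N.+1 1 <= K * expR (- (c * ln N.+1%:R)).
Proof.
move=> p1_gt0 eps12; have /andP[eps0 epsle] := eps12.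
have p101 : 0 < p 1 < 1 by rewrite p1_gt0.
have p1le : p 1 <= 1 by exact: ltW.
(* One window, of half-width d N around p 1 * N, serves both estimates. *)
have [d1 [K1 [d10 K10 long]]] := long_runs_rare p101 eps0.
have [d2 [K2 [y2 [d20 K20 short]]]] := short_runs_rare p101 eps12.
pose d := Num.min (Num.min d1 d2) 1.
have d01 : 0 < d <= 1 by rewrite !lt_min d10 d20 ltr01 ge_min lexx orbT.
have /andP[d0 dle1] := d01.
have dd1 : d <= d1 by rewrite !ge_min lexx.
have dd2 : d <= d2 by rewrite !ge_min lexx orbT.
(* q is half of the Chernoff rate: Z_n decays slower than exp (- q n). *)
pose q := d ^+ 2 / 16.
have q0 : 0 < q by rewrite divr_gt0 ?exprn_gt0.
have x1 : 1 < expR q by rewrite -expR0 ltr_expR.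
have [k k1 pk] := exists_branching.
have [c0 c00 subexp] := forest_mass_subexp p_ge0 p0_gt0 p_sum p_mean x1 k1 pk
  p1_gt0 p1le.
exists (K1 + K2 + 2 / c0 * expR (2 * q)), (Num.min (eps / 4) q), (Num.max y2 1).
split; first by rewrite lt_min q0 andbT; lra.
move=> N; set y := ln _; rewrite ge_max => /andP[ly2 ly1].
pose a := - ln (p 1).
have a0 : 0 < a by rewrite oppr_gt0 ln_lt0.
have L0 : 0 < y / a by rewrite divr_gt0 //; lra.
pose hp := Num.trunc ((1 + eps) * (y / a)).
pose hm := (Num.trunc ((1 - eps) * (y / a))).+1.
have hpP : (hp%:R <= (1 + eps) * (y / a)) /\ ((1 + eps) * (y / a) - 1 <= hp%:R).
  have /truncn_itv /andP[] : 0 <=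
    (1 + eps) * (y / a) by rewrite mulr_ge0 ?ltW //; lra.
  rewrite -/hp -natr1; lra.
have hmP : ((1 - eps) * (y / a) <= hm%:R) /\ (hm%:R <= (1 - eps) * (y / a) + 1).
  have /truncn_itv /andP[] : 0 <=
    (1 - eps) * (y / a) by rewrite mulr_ge0 ?ltW //; lra.
  rewrite -/hm => t1 t2; split; first exact: ltW.
  by rewrite /hm -natr1; lra.
pose B (S : {set 'I_N}) := has_run hp S || ~~ has_run hm S.
pose W (k : nat) := `|k%:R - p 1 * N%:R| <= d * N%:R.
pose E := (K1 + K2) * expR (- (eps / 4 * y)).
have Bsound s : s \in forests N.+1 1 ->
    eps < `| (Hbar1 (head leaf s))%:R / (y / a) - 1 | ->
      B (unary_positions N s).
  move=> sF; have [t st] : exists t, s = [:: t].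
    by move: sF; rewrite mem_forests; case: s => [|t [|]] //; exists t.
  rewrite {s}st in sF *; rewrite /B !has_run_Hbar1 //= -ltnNge ltr_normr =>
    /orP[far|far].
    rewrite -(ler_nat R) (le_trans hpP.1) //.
    by rewrite -ler_pdivlMr //; lra.
  apply/orP; right; rewrite -(ltr_nat R); apply: lt_le_trans hmP.1.
  by rewrite -ltr_pdivrMr //; lra.
have E0 : 0 <= E by rewrite mulr_ge0 ?expR_ge0 ?addr_ge0.
have le4 : expR (- (eps / 2 * y)) <= expR (- (eps / 4 * y)).
  have : 0 <= eps * y by rewrite mulr_ge0 //; lra.
  by rewrite ler_expR; lra.
have Bcard j : W j ->
    #|[set S : {set 'I_N} | B S && (#|S| == j)]|%:R <= E * 'C(N, j)%:R.
  rewrite /W ler_norml => /andP[Wl Wr].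
  have [leN|ltN] := leqP j N; last first.
    apply: (@le_trans _ _ 'C(N, j)%:R); first by rewrite ler_nat card_ksets_sub.
    by rewrite bin_small // mulr0.
  have dN1 : d * N%:R <= d1 * N%:R by rewrite ler_wpM2r.
  have dN2 : d * N%:R <= d2 * N%:R by rewrite ler_wpM2r.
  have up : j%:R <= (p 1 + d1) * N%:R by lra.
  have dn : (p 1 - d2) * N%:R <= j%:R by lra.
  have b1 := long N j hp leN up hpP.2.
  have b2 := short N j hm leN dn isT hmP.2 ly2.
  have cup : #|[set S : {set 'I_N} | B S && (#|S| == j)]|%:R <=
     #|[set S : {set 'I_N} | has_run hp S && (#|S| == j)]|%:R +
     #|[set S : {set 'I_N} | ~~ has_run hm S && (#|S| == j)]|%:R :> R.
    rewrite -natrD ler_nat; apply: leq_trans (leq_card_setU _ _).1.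
    by apply: subset_leq_card; apply/fintype.subsetP => S;
      rewrite !inE andb_orl.
  apply: (le_trans cup); rewrite /E mulrDl mulrDl; apply: lerD => //.
  apply: (le_trans b1); rewrite ler_wpM2r // ler_wpM2l //.
have main := @mass_le_positions _ p p_ge0 partial_mass_le1 N _ B W E Bsound
  Bcard E0.
have tail := binomial_tail N (_ : 0 <= p 1 <= 1) d01.
have Z0 : 0 < forest_mass p N.+1 1.
  apply: lt_le_trans (forest_mass_unary p_ge0 N).
  by rewrite mulr_gt0 ?exprn_gt0 ?p0_gt0.
rewrite ler_pdivrMr //; apply: (le_trans main).
have {}tail : \sum_(k < N.+1 | ~~ W k) 'C(N, k)%:R * (p 1 ^+ k * (1 - p 1) ^+
  (N - k)) <=
   2 * expR (- (2 * q * N%:R)).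
  have -> : 2 * q = d ^+ 2 / 8 by rewrite /q; field.
  by apply: tail; rewrite p_ge0.
apply: (le_trans (lerD (lexx _) tail)).
have y_le : y <= N.+1%:R.
  have : 0 < N.+1%:R :> R by rewrite ltr0n.
  by move=> /ln_sublinear; exact: ltW.
have Zlow : c0 * expR (- (q * N.+1%:R)) <= forest_mass p N.+1 1.
  rewrite expRN ler_pdivrMr ?expR_gt0 // mulrC expRM_natr mulrC.
  exact: subexp.
have tail2 : 2 * expR (- (2 * q * N%:R)) <=
    2 / c0 * expR (2 * q) * expR (- (q * y)) * forest_mass p N.+1 1.
  have e2 : 0 <= 2 / c0 * expR (2 * q) * expR (- (q * y)).
    by rewrite !mulr_ge0 ?expR_ge0 ?invr_ge0 // ltW.
  apply: le_trans (ler_wpM2l e2 Zlow).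
  have -> : 2 / c0 * expR (2 * q) * expR (- (q * y)) * (c0 * expR (- (q *
    N.+1%:R))) =
      2 * (expR (2 * q) * expR (- (q * y)) * expR (- (q * N.+1%:R))).
    by field; rewrite gt_eqF.
  rewrite -!expRD ler_wpM2l // ler_expR -natr1.
  have : q * y <= q * N.+1%:R by rewrite ler_wpM2l // ltW.
  by rewrite -natr1; lra.
apply: (le_trans (lerD (lexx _) tail2)); rewrite -mulrDl ler_wpM2r ?(ltW Z0) //.
rewrite [leRHS]mulrDl; set m := Num.min _ _.
have m1 : m <= eps / 4 by rewrite ge_min lexx.
have m2 : m <= q by rewrite ge_min lexx orbT.
apply: lerD; rewrite ler_wpM2l ?addr_ge0 ?mulr_ge0 ?expR_ge0 ?invr_ge0 ?(ltW
  c00) //.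
  by rewrite ler_expR lerN2 ler_wpM2r //; lra.
by rewrite ler_expR lerN2 ler_wpM2r //; lra.
Qed.

End critical_offspring.

(** * Convergence in probability *)

Local Open Scope classical_set_scope.

Theorem lemma28 (R : realType)
    (d : measure_display) (S : measurableType d) (P : probability S R)
    (xi : {RV P >-> nat})
    (d' : measure_display) (Omega : measurableType d') (Q : probability Omega R)
    (X : seq nat -> {RV Q >-> nat})
    (mean1 : ('E_P[fun w => (xi w)%:R] = 1)%E)
    (var_gt0 : (0 < 'V_P[fun w => (xi w)%:R])%E)
    (var_fin : ('V_P[fun w => (xi w)%:R] < +oo)%E)
    (X_law : forall u B, distribution Q (X u) B = distribution P xi B)
    (X_indep : mutually_independent X)
    (p1 : R) (p1E : p1 = fine (P [set w | xi w = 1%N])) (p1_gt0 : 0 < p1)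
    (eps : R) (eps_gt0 : 0 < eps) :
  cond_GW X n
    [set t | eps < `| (Hbar1 t)%:R / logb p1^-1 n%:R - 1 |] @[n --> \oo] --> 0.
Proof.
pose p := offspring_prob xi.
have {p1E} p1E : p1 = p 1 by [].
have p_ge0 : forall k, 0 <= p k := offspring_prob_ge0 xi.
have p_sum := offspring_prob_sum xi.
have p_mean := offspring_prob_mean mean1.
have p1_lt1 : p 1 < 1 := offspring_prob1_lt1 mean1 var_gt0.
(* Shrinking eps enlarges the event, and 1 - eps stays away from 0. *)
pose eps' := Num.min eps (1 / 2).
have eps'0 : 0 < eps' <= 1 / 2.
  by rewrite ge_min lexx orbT andbT lt_min eps_gt0; lra.
rewrite p1E in p1_gt0 *.
have [K [c [y0 [c0 tail]]]] :=
  chain_height_tail p_ge0 p_sum p_mean p1_lt1 p1_gt0 eps'0.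
apply/cvgr0Pnorm_lt => e e0; near=> n.
have Kpos : 0 < `|K| + 1 by rewrite ltr_wpDl.
have y0n : expR y0 < n%:R by near: n; exact: nbhs_infty_gtr.
have en : expR (- ln (e / (`|K| + 1)) / c) < n%:R by near: n;
  exact: nbhs_infty_gtr.
have n0 : 0 < n%:R :> R by apply: lt_trans y0n; exact: expR_gt0.
have [N nE] : exists N, n = N.+1 by exists n.-1; rewrite prednK // -(ltr0n R).
rewrite nE in y0n en n0 *.
rewrite (cond_GWE X_law X_indep) -/p ger0_norm; last first.
  by rewrite divr_ge0 ?forest_mass_ge0 // sumr_ge0 // => s _; exact: weight_ge0.
apply: (@le_lt_trans _ _ (K * expR (- (c * ln N.+1%:R)))).
  have y0N : y0 <= ln N.+1%:R by rewrite -ler_expR lnK // ltW.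
  apply: le_trans (tail N y0N).
  rewrite ler_wpM2r ?invr_ge0 ?forest_mass_ge0 // big_mkcond [leRHS]big_mkcond.
  apply: ler_sum => s _; case: ifPn => [/asboolP /=|_]; last first.
    by case: ifP => // _; exact: weight_ge0.
  rewrite /logb lnV // => far.
  by rewrite ifT //; apply: le_lt_trans far; rewrite ge_min lexx.
have : expR (- (c * ln N.+1%:R)) < e / (`|K| + 1).
  rewrite -[ltRHS]lnK ?posrE ?divr_gt0 // ltr_expR ltrNl [ltRHS]mulrC
    -ltr_pdivrMr //.
  by rewrite -ltr_expR [ltRHS]lnK.
rewrite ltr_pdivlMr // => small.
apply: le_lt_trans small; rewrite mulrC ler_wpM2l ?expR_ge0 //.
by apply: le_trans (ler_norm K) _; rewrite lerDl.
Unshelve. all: by end_near. Qed.
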